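(* Suppose $\mu:=\mathbb{E}[\xi]\in(-\infty,\infty)$ and $\mathbb{P}\{\eta>x\}\sim x^{-\alpha}\ell(x)$ as $x\to\infty$ for some $\alpha\in(0,1)$ and some $\ell$ slowly varying at $\infty$. Then, as $t\to\infty$, $$\big(\mathbb{P}\{\eta>t\}\,\tau(ut)\big)_{u\ge0}\ \Longrightarrow\ \Big(\inf\Big\{z\ge0:\ \max_{k:\,t_k^{(1,\alpha)}\le z}j_k^{(1,\alpha)}>u\Big\}\Big)_{u\ge0}=:(Y(u))_{u\ge0}$$ in the $M_1$-topology on $D$. The one-dimensional distributions of the limit process, which is the inverse of an extremal process, are exponential and given by $$\mathbb{P}\{Y(u)>x\}=e^{-u^{-\alpha}x},\quad x,u>0.$$
   Context: Let $(\xi_1,\eta_1),(\xi_2,\eta_2),\ldots$ be independent copies of an $\mathbb{R}^2$-valued random vector $(\xi,\eta)$ with arbitrarily dependent components. Put $S_0:=0$, $S_n:=\xi_1+\ldots+\xi_n$ for $n\in\mathbb{N}=\{1,2,\ldots\}$, and $T_n:=S_{n-1}+\eta_n$ for $n\in\mathbb{N}$ (the globally perturbed random walk). For $t\in\mathbb{R}$ define the first passage time $\tau(t):=\inf\{n\ge1:T_n>t\}$, with the convention $\inf\varnothing=\infty$. For $a,b>0$, $(t_k^{(a,b)},j_k^{(a,b)})$ denote the atoms of a Poisson random measure $N^{(a,b)}$ on $[0,\infty)\times(0,\infty)$ with mean measure $\mathbb{LEB}\times\mu_{a,b}$, where $\mathbb{LEB}$ is Lebesgue measure on $[0,\infty)$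 and $\mu_{a,b}$ is the measure on $(0,\infty]$ defined by $\mu_{a,b}((x,\infty])=ax^{-b}$ for $x>0$. The extremal process referred to is $z\mapsto\max_{k:\,t_k^{(1,\alpha)}\le z}j_k^{(1,\alpha)}$. $D=D[0,\infty)$ is the Skorokhod space of càdlàg functions on $[0,\infty)$, here equipped with the standard Skorokhod $M_1$-topology; $\Longrightarrow$ denotes weak convergence in this function space. $f\sim g$ means $f/g\to1$. *)

(* Defs.v *)
From HB Require Import structures.
From mathcomp Require Import all_boot all_order all_algebra.
From mathcomp Require Import all_classical all_reals all_analysis measurable_realfun.

Set Implicit Arguments.
Unset Strict Implicit.
Unset Printing Implicit Defensive.

Import Order.TTheory GRing.Theory Num.Theory.
Import numFieldNormedType.Exports.

Local Open Scope classical_set_scope.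
Local Open Scope ring_scope.

Section Skorokhod.
Variable R : realType.

(* A function on [0, +oo) is encoded by its extension to R that is constant on
   ]-oo, 0]; then its left limit at 0 is its value at 0, the usual convention
   x(0-) = x(0). *)
Definition is_cadlag (x : R -> R) : Prop :=
  [/\ forall t : R, 0 <= t -> x s @[s --> t^'+] --> x t,
      forall t : R, 0 <= t -> cvg (x s @[s --> t^'-]) &
      forall t : R, t < 0 -> x t = x 0].

Lemma is_cadlag0 : is_cadlag (fun=> 0).
Proof.
split=> // t _; first exact: cvg_cst.
by apply/cvg_ex; exists 0; exact: cvg_cst.
Qed.

Record skorokhod := Skorokhod { skorokhod_fun :> R -> R;
  skorokhod_cadlag : is_cadlag skorokhod_fun }.

HB.instance Definition _ := gen_eqMixin skorokhod.
HB.instance Definition _ := gen_choiceMixin skorokhod.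
HB.instance Definition _ := isPointed.Build skorokhod (Skorokhod is_cadlag0).

Definition left_lim (x : R -> R) (t : R) : R := lim (x s @[s --> t^'-]).

(* The order on completed graphs, parametric representations and the M1-metric
   on D[0, T] follow Whitt, Stochastic-Process Limits, Section 12.3. *)
Definition completed_graph (x : skorokhod) (T : R) : set (R * R) :=
  [set p | 0 <= p.2 <= T /\
     exists2 a : R, 0 <= a <= 1 & p.1 = a * left_lim x p.2 + (1 - a) * x p.2].

Definition graph_le (x : skorokhod) (p q : R * R) : Prop :=
  p.2 < q.2 \/
  (p.2 = q.2 /\ `|left_lim x p.2 - p.1| <= `|left_lim x q.2 - q.1|).

Definition param_rep (x : skorokhod) (T : R) (u r : R -> R) : Prop :=
  [/\ {within `[0, 1], continuous u}, {within `[0, 1], continuous r},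
      [set (u s, r s) | s in `[0, 1]] = completed_graph x T &
      forall s s' : R, 0 <= s -> s <= s' -> s' <= 1 ->
        graph_le x (u s, r s) (u s', r s')].

Definition sup_dist01 (f g : R -> R) : \bar R :=
  ereal_sup [set `|f s - g s|%:E | s in `[0, 1]].

Definition m1_dist (T : R) (x y : skorokhod) : \bar R :=
  ereal_inf [set e | exists u1 r1 u2 r2 : R -> R, [/\ param_rep x T u1 r1,
    param_rep y T u2 r2 & e = maxe (sup_dist01 u1 u2) (sup_dist01 r1 r2)]].

(* Convergence in D[0, +oo): the restrictions to [0, T] converge for every
   continuity point T > 0 of the limit (ibid., Section 12.9). *)
Definition m1_cvg (x_ : nat -> skorokhod) (x : skorokhod) : Prop :=
  forall T : R, 0 < T -> {for T, continuous x} ->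
    m1_dist T (x_ n) x @[n --> \oo] --> 0%E.

(* This convergence is metrizable, so the M1-topology consists of the
   sequentially open sets. *)
Definition m1_open (U : set skorokhod) : Prop :=
  forall x (x_ : nat -> skorokhod), U x -> m1_cvg x_ x ->
    \forall n \near \oo, U (x_ n).

Lemma m1_openT : m1_open setT.
Proof. by move=> x x_ _ _; exact: nearW. Qed.

Lemma m1_openI : setI_closed m1_open.
Proof.
move=> U V oU oV x x_ [Ux Vx] xx.
by apply: filterI; [exact: oU xx | exact: oV xx].
Qed.

Lemma m1_open_bigU (I : Type) (f : I -> set skorokhod) :
  (forall i, m1_open (f i)) -> m1_open (\bigcup_i f i).
Proof.
move=> of_ x x_ [i _ fix_] xx.
by apply: filterS (of_ i x x_ fix_ xx) => n ?; exists i.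
Qed.

HB.instance Definition _ := isOpenTopological.Build skorokhod
  m1_openT m1_openI m1_open_bigU.

Definition is_path (f : R -> \bar R) (x : skorokhod) : Prop :=
  forall u, 0 <= u -> f u = (x u)%:E.

(* The element of D given by f on [0, +oo); the zero path if there is none. *)
Definition to_path (f : R -> \bar R) : skorokhod := xget point (is_path f).

(* Almost every path of X lies in D, and the resulting element of D is
   measurable for the Borel sigma-algebra of the M1-topology. *)
Definition random_path d (Omega : measurableType d) (P : probability Omega R)
    (X : Omega -> R -> \bar R) : Prop :=
  {ae P, forall w, exists x, is_path (X w) x} /\
  measurable_fun setT
    (fun w => to_path (X w) : g_sigma_algebraType (@open skorokhod)).

Definition cvg_law_M1 d d' (Omega : measurableType d) (P : probability Omega R)
    (Omega' : measurableType d') (P' : probability Omega' R)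
    (X : R -> Omega -> R -> \bar R) (Y : Omega' -> R -> \bar R) : Prop :=
  [/\ \forall t \near +oo, random_path P (X t), random_path P' Y &
      forall f : skorokhod -> R, continuous f ->
        (exists M : R, forall x, `|f x| <= M) ->
        ('E_P[fun w => f (to_path (X t w))])%E @[t --> +oo] -->
        ('E_P'[fun w => f (to_path (Y w))])%E].

End Skorokhod.

Section Probability.
Variable R : realType.

Definition mutually_independent d d' (Omega : measurableType d)
    (P : probability Omega R) (E : measurableType d') (I : eqType)
    (X : I -> Omega -> E) : Prop :=
  forall (s : seq I) (A : I -> set E), uniq s ->
    (forall i, measurable (A i)) ->
    P (\big[setI/setT]_(i <- s) (X i @^-1` A i)) =
    (\prod_(i <- s) P (X i @^-1` A i))%E.

Definition independent_copies d (Omega : measurableType d)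
    (P : probability Omega R) (xi eta : {RV P >-> R})
    (xi_ eta_ : nat -> {RV P >-> R}) : Prop :=
  mutually_independent P (fun k w => (xi_ k w, eta_ k w)) /\
  forall k (B : set (R * R)), measurable B ->
    P [set w | B (xi_ k w, eta_ k w)] = P [set w | B (xi w, eta w)].

Definition slowly_varying (l : R -> R) : Prop :=
  (exists A : R, measurable_fun (`]A, +oo[ : set R) l /\ forall x, A < x -> 0 < l x) /\
  forall c : R, 0 < c -> l (c * x) / l x @[x --> +oo] --> (1 : R).

Definition tail d (Omega : measurableType d) (P : probability Omega R)
  (X : Omega -> R) (x : R) : R := fine (P [set w | x < X w]).

(* Index k here is index k + 1 in the usual (xi_1, eta_1), (xi_2, eta_2), ... *)
Definition walk Omega (xi_ : nat -> Omega -> R) (n : nat) (w : Omega) : R :=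
  \sum_(k < n) xi_ k w.

Definition pert_walk Omega (xi_ eta_ : nat -> Omega -> R) (n : nat)
  (w : Omega) : R := walk xi_ n.-1 w + eta_ n.-1 w.

Definition first_passage Omega (xi_ eta_ : nat -> Omega -> R) (t : R)
    (w : Omega) : \bar R :=
  ereal_inf [set (n%:R)%:E | n in
    [set n : nat | (1 <= n)%N /\ t < pert_walk xi_ eta_ n w]].

(* mu_{a,b}; the tails determine it on ]0, +oo[ and leave no mass at +oo. *)
Definition is_mu (a b : R) (m : {measure set R -> \bar R}) : Prop :=
  m [set` `]-oo, 0]] = 0%E /\
  forall x : R, 0 < x -> m [set` `]x, +oo[] = (a * x `^ (- b))%:E.

Definition mean_measure (m : {sigma_finite_measure set R -> \bar R}) :
    set (R * R) -> \bar R :=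
  product_measure1
    (mrestr (@lebesgue_measure R) (measurable_itv (`[0, +oo[%R : interval R))) m.

Definition count_atoms Omega (p : nat -> Omega -> R * R) (A : set (R * R))
    (w : Omega) : \bar R :=
  (\sum_(0 <= k <oo) \d_(p k w) A)%E.

(* N = sum_k delta_(t_k, j_k) is a Poisson random measure with mean measure m
   on [0, +oo) x ]0, +oo[. *)
Definition poisson_atoms d (Omega : measurableType d) (P : probability Omega R)
    (t_ j_ : nat -> {RV P >-> R}) (m : set (R * R) -> \bar R) : Prop :=
  let N := count_atoms (fun k w => (t_ k w, j_ k w)) in
  [/\ forall k w, 0 <= t_ k w /\ 0 < j_ k w,
      forall A, measurable A -> (m A < +oo)%E -> forall n : nat,
        P [set w | N A w = (n%:R)%:E] =
        (fine (m A) ^+ n / (n`!)%:R * expR (- fine (m A)))%:E,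
      forall A, measurable A -> m A = +oo%E -> P [set w | N A w = +oo%E] = 1%E &
      forall A : nat -> set (R * R), (forall i, measurable (A i)) ->
        trivIset setT A -> mutually_independent P (fun i : nat => N (A i))].

Definition extremal Omega (t_ j_ : nat -> Omega -> R) (w : Omega) (z : R) :
    \bar R :=
  ereal_sup [set (j_ k w)%:E | k in [set k | t_ k w <= z]].

Definition inverse_extremal Omega (t_ j_ : nat -> Omega -> R) (w : Omega)
    (u : R) : \bar R :=
  ereal_inf [set z%:E | z in [set z | 0 <= z /\ (u%:E < extremal t_ j_ w z)%E]].

End Probability.

(* Main.v *)
Require Import Defs.
From HB Require Import structures.
From mathcomp Require Import all_boot all_order all_algebra.
From mathcomp Require Import all_classical all_reals all_analysis measurable_realfun.
From mathcomp Require Import ring lra.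

(** Write a(t) for the probability that eta exceeds t.  Measured in units of
    1 / a(t), the passage time over u t is at least x exactly when none of the
    points T_n with n < x / a(t) exceeds u t.  The function a is regularly
    varying of index - alpha > -1, so t a(t) tends to infinity
    (regvar_mul_pinfty); as xi is integrable, the sums S_n with n of order
    1 / a(t) are then o(t) in probability (absum_negligible), and T_n may be
    replaced by eta_n at the price of a small change of the levels.  For the
    independent eta_n, a finite-dimensional event is a product of powers of
    1 - a(u t) with exponents of order 1 / a(t); since a(u t) / a(t) tends to
    u^(- alpha), its probability converges (eta_below_cvg, above_cvg).  The
    limit is exp(- m), where m is the mean measure of a staircase region, that
    is, the probability that the Poisson random measure has no atom in that
    region (mean_measure_region, probability_above), and this is the
    corresponding event for the inverse extremal process.

    The passage from finite-dimensional distributions to the M1-topology rests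
    on monotonicity.  Nondecreasing paths that converge at all nonnegative
    rationals converge in M1 (nd_m1_cvg): the completed graphs, parametrized by
    the sum of time and value, are then uniformly close.  Hence, among
    nondecreasing paths, an M1-open set is a countable union of cylinders in the
    rational coordinates (open_literals).  This gives both the Borel
    measurability of the path-valued maps (exit_random_path) and the lower bound
    for the probabilities of open sets (open_liminf), from which the convergence
    of expectations of bounded continuous functions follows (fdd_cvg_law_M1).

    The rescaled passage times and the inverse extremal process are both of the
    form u |-> inf of c_k over the k with u < h_k (first_exit), so they are
    treated together.  That the passage times are almost surely finite is read
    off from the limit as well (passage_exit_process). *)

Set Implicit Arguments.
Unset Strict Implicit.
Unset Printing Implicit Defensive.

Import Order.TTheory GRing.Theory Num.Theory.
Import numFieldNormedType.Exports.

Local Open Scope classical_set_scope.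
Local Open Scope ring_scope.

(** * Parametric representations of nondecreasing paths *)

Section MonotoneM1.
Variable R : realType.
Implicit Types (x y : skorokhod R) (s t v T : R).

Definition nd_path (x : R -> R) : Prop :=
  forall s t : R, 0 <= s -> s <= t -> x s <= x t.

Lemma left_limP x t : nd_path x -> 0 < t ->
  (forall s, 0 <= s -> s < t -> x s <= left_lim x t) /\
  (forall c, (forall s, 0 <= s -> s < t -> x s <= c) -> left_lim x t <= c).
Proof.
move=> ndx t0; have [_ /(_ t (ltW t0)) cx _] := skorokhod_cadlag x; split.
  move=> s s0 st; apply: limr_ge => //; near=> r; apply: ndx => //.
  by near: r; exact: nbhs_left_ge.
move=> c xc; apply: limr_le => //; near=> r; apply: xc => //.
  by near: r; exact: nbhs_left_ge.
Unshelve. all: by end_near. Qed.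

(** Paths are extended by a constant to the left of 0, so the completed
    graph has no vertical segment there. *)
Lemma left_lim0 x : left_lim x 0 = x 0.
Proof.
have [_ _ x0] := skorokhod_cadlag x.
apply: cvg_lim => //; apply: (cvg_near_cst (x 0)).
by near=> r; apply: x0; near: r; exact: nbhs_left_lt.
Unshelve. all: by end_near. Qed.

Lemma left_lim_le x t : nd_path x -> 0 <= t -> left_lim x t <= x t.
Proof.
move=> ndx; rewrite le_eqVlt => /predU1P[<-|t0]; first by rewrite left_lim0.
by apply: (left_limP ndx t0).2 => s s0 /ltW; exact: ndx.
Qed.

(** For v >= x 0, the time coordinate of the point where the completed graph
    of x meets the antidiagonal time + value = v; for nondecreasing x there
    is only one such point, because t + x t is strictly increasing. *)
Definition entry_time (x : R -> R) v : R := inf [set t | 0 <= t /\ v < t + x t].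

Let entry_set0 x v : nd_path x -> [set t | 0 <= t /\ v < t + x t] !=set0.
Proof.
move=> ndx; exists (`|v - x 0| + 1); split; first by rewrite addr_ge0.
have : x 0 <= x (`|v - x 0| + 1) by apply: ndx => //; rewrite addr_ge0.
have := ler_norm (v - x 0); lra.
Qed.

Lemma entry_time_ge0 x v : nd_path x -> 0 <= entry_time x v.
Proof.
by move=> ndx; apply: lb_le_inf => [|t []//]; exact: entry_set0.
Qed.

Lemma entry_time_le x v t : nd_path x -> 0 <= t -> v < t + x t ->
  entry_time x v <= t.
Proof. by move=> ndx t0 vt; apply: ge_inf => //; exists 0 => ? []. Qed.

Lemma le_entry_time x v t : nd_path x -> t + x t <= v -> t <= entry_time x v.
Proof.
move=> ndx tv; apply: lb_le_inf; first exact: entry_set0.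
move=> s [s0 vs]; rewrite leNgt; apply/negP => st.
by have := ndx s t s0 (ltW st); lra.
Qed.

Lemma entry_time_lt x v t : nd_path x -> entry_time x v < t -> v < t + x t.
Proof.
move=> ndx /inf_lt[|s [s0 vs] st]; first exact: entry_set0.
by have := ndx s t s0 (ltW st); lra.
Qed.

Lemma lt_entry_time x v t : nd_path x -> 0 <= t -> t < entry_time x v ->
  t + x t <= v.
Proof.
move=> ndx t0 tE; rewrite leNgt; apply/negP => vt.
by have := entry_time_le ndx t0 vt; lra.
Qed.

(** With entry_time_left: at time entry_time x v, the path jumps across the
    value v - entry_time x v or takes it. *)
Lemma entry_time_right x v : nd_path x ->
  v <= entry_time x v + x (entry_time x v).
Proof.
move=> ndx; have [/(_ _ (entry_time_ge0 v ndx)) cx _ _] := skorokhod_cadlag x.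
set F := entry_time x v in cx *.
have cF : s + x s @[s --> F^'+] --> F + x F.
  by apply: cvgD => //; apply: cvg_at_right_filter; exact: cvg_id.
rewrite -(cvg_lim _ cF)//; apply: limr_ge.
  by apply/cvg_ex; exists (F + x F).
by near=> s; apply/ltW/entry_time_lt.
Unshelve. all: by end_near. Qed.

Lemma entry_time_left x v : nd_path x -> x 0 <= v ->
  entry_time x v + left_lim x (entry_time x v) <= v.
Proof.
move=> ndx xv; have := entry_time_ge0 v ndx.
rewrite le_eqVlt => /predU1P[<-|F0]; first by rewrite left_lim0 add0r.
rewrite -lerBrDl; apply: (left_limP ndx F0).2 => s s0 sF.
rewrite lerBrDl leNgt; apply/negP => vlt.
set F := entry_time x v in F0 sF vlt.
pose r := Num.max s (v - x s).
have rF : r < F by rewrite /r gt_max sF/=; lra.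
have [h1 h2] : (s <= r) /\ (v - x s <= r) by rewrite !le_max !lexx orbT.
have r2 : r < (r + F) / 2 by lra.
have : v < (r + F) / 2 + x ((r + F) / 2).
  have : x s <= x ((r + F) / 2) by apply: ndx => //; lra.
  lra.
move=> /(entry_time_le ndx) => /(_ ltac:(lra)); rewrite -/F; lra.
Qed.

(** Time and value both increase along the graph and add up to v. *)
Lemma entry_time_lip x v w : nd_path x -> v <= w ->
  entry_time x v <= entry_time x w <= entry_time x v + (w - v).
Proof.
move=> ndx vw; apply/andP; split.
  apply: lb_le_inf; first exact: entry_set0.
  by move=> t [t0 wt]; apply: entry_time_le => //; lra.
apply/ler_addgt0Pr => e e0; have E0 := entry_time_ge0 v ndx.
apply: entry_time_le => //; first lra.
have := @entry_time_lt x v (entry_time x v + e) ndx ltac:(lra).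
have := ndx (entry_time x v + e) (entry_time x v + (w - v) + e) ltac:(lra)
  ltac:(lra).
lra.
Qed.

Lemma entry_time_dist x v w : nd_path x ->
  `|entry_time x v - entry_time x w| <= `|v - w|.
Proof.
move=> ndx; wlog vw : v w / v <= w => [H|].
  have [/H//|/ltW/H] := leP v w; rewrite distrC (distrC w)//.
have /andP[h1 h2] := entry_time_lip ndx vw.
by rewrite distrC (distrC v) !ger0_norm; lra.
Qed.

Lemma dist1_continuous (f : R -> R) (c : R) : 0 < c ->
  (forall s t, `|f s - f t| <= c * `|s - t|) -> continuous f.
Proof.
move=> c0 lf t; apply/cvgrPdist_le => /= e e0; near=> s.
rewrite (le_trans (lf _ _))// mulrC -ler_pdivlMr//; near: s.
by apply: cvgr_dist_le; [exact: cvg_id|exact: divr_gt0].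
Unshelve. all: by end_near. Qed.

(** Over the times 0 to T, the sum of time and value runs through an
    interval of this length, which the definitions below rescale to the unit
    interval. *)
Definition graph_len x T := T + x T - x 0.
Definition graph_arg x T s := x 0 + s * graph_len x T.
Definition graph_time x T s := entry_time x (graph_arg x T s).
Definition graph_val x T s := graph_arg x T s - graph_time x T s.

Lemma graph_len_gt0 x T : nd_path x -> 0 < T -> 0 < graph_len x T.
Proof.
by move=> ndx T0; have := ndx 0 T (lexx _) (ltW T0); rewrite /graph_len; lra.
Qed.

Lemma graph_time_dist x T s t : nd_path x -> 0 < T ->
  `|graph_time x T s - graph_time x T t| <= graph_len x T * `|s - t|.
Proof.
move=> ndx T0; apply: le_trans (entry_time_dist _ _ ndx) _.
rewrite /graph_arg opprD addrACA subrr add0r -mulrBl normrM mulrC.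
by rewrite (gtr0_norm (graph_len_gt0 ndx T0)).
Qed.

Lemma graph_val_dist x T s t : nd_path x -> 0 < T ->
  `|graph_val x T s - graph_val x T t| <= (2 * graph_len x T) * `|s - t|.
Proof.
move=> ndx T0; rewrite /graph_val opprD addrACA (le_trans (ler_normD _ _))//.
rewrite -opprD normrN mulrDl mul1r mulrDl lerD//; last exact: graph_time_dist.
rewrite /graph_arg opprD addrACA subrr add0r -mulrBl normrM mulrC.
by rewrite (gtr0_norm (graph_len_gt0 ndx T0)).
Qed.

Lemma completed_graph_nd x T p : nd_path x -> completed_graph x T p <->
  0 <= p.2 <= T /\ left_lim x p.2 <= p.1 <= x p.2.
Proof.
move=> ndx; split=> [[pT [a /andP[a0 a1] ->]]|[pT /andP[h1 h2]]]; split => //.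
  have /andP[p0 _] := pT; have := left_lim_le ndx p0.
  by move=> h; apply/andP; split; nra.
have [e|ne] := eqVneq (left_lim x p.2) (x p.2).
  by exists 0; rewrite ?lexx ?ler01// e mul0r add0r subr0 mul1r; lra.
have d0 : 0 < x p.2 - left_lim x p.2.
  by rewrite subr_gt0 lt_neqAle ne left_lim_le//; case/andP: pT.
exists ((x p.2 - p.1) / (x p.2 - left_lim x p.2)).
  by apply/andP; split; [apply: divr_ge0|rewrite ler_pdivrMr//]; lra.
by field; rewrite gt_eqF.
Qed.

(** Every point of the completed graph lies on exactly one antidiagonal, and
    moving up the antidiagonals follows the order of the graph. *)
Lemma graph_param_rep x T : nd_path x -> 0 < T ->
  param_rep x T (graph_val x T) (graph_time x T).
Proof.
move=> ndx T0; have L0 := graph_len_gt0 ndx T0; split.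
- apply: continuous_subspaceT; apply: (@dist1_continuous _ (2 * graph_len x T)).
    by rewrite mulr_gt0.
  by move=> s t; exact: graph_val_dist.
- apply: continuous_subspaceT; apply: (dist1_continuous L0) => s t.
  exact: graph_time_dist.
- apply/seteqP; split=> [_ [s + <-]|[u r]].
    rewrite /= in_itv/= => /andP[s0 s1]; apply/completed_graph_nd => //=.
    have v0 : x 0 <= graph_arg x T s.
      by rewrite lerDl mulr_ge0// ltW.
    have vT : graph_arg x T s <= T + x T.
      have -> : T + x T = x 0 + 1 * graph_len x T by rewrite /graph_len; lra.
      by rewrite lerD2l ler_pM2r.
    rewrite entry_time_ge0//=; split.
      apply/ler_addgt0Pr => e e0; apply: entry_time_le => //; first lra.
      by have := ndx T (T + e) (ltW T0) ltac:(lra); lra.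
    rewrite /graph_val /graph_time lerBrDl lerBlDl.
    by rewrite entry_time_left// entry_time_right.
  move=> /(completed_graph_nd _ _ ndx)/= [/andP[r0 rT] /andP[h1 h2]].
  have ur : entry_time x (u + r) = r.
    apply/eqP; rewrite eq_le; apply/andP; split.
      apply/ler_addgt0Pr => e e0; apply: entry_time_le => //; first by lra.
      by have := ndx r (r + e) r0 ltac:(lra); lra.
    rewrite leNgt; apply/negP => lt; have E0 := entry_time_ge0 (u + r) ndx.
    have r'0 : 0 < r by lra.
    pose q := (entry_time x (u + r) + r) / 2.
    have := @entry_time_lt x (u + r) q ndx ltac:(rewrite /q; lra).
    have := (left_limP ndx r'0).1 q ltac:(rewrite /q; lra)
      ltac:(rewrite /q; lra).
    by rewrite /q; lra.
  exists ((u + r - x 0) / graph_len x T); last first.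
    rewrite /graph_val /graph_time /graph_arg divfK ?gt_eqF//.
    by rewrite (addrC (x 0)) subrK ur addrK.
  have u0 : x 0 <= u.
    apply: le_trans h1; move: r0; rewrite le_eqVlt => /predU1P[<-|r0].
      by rewrite left_lim0.
    exact: (left_limP ndx r0).1.
  rewrite /= in_itv/= divr_ge0 ?ler_pdivrMr ?mul1r ?(ltW L0)//=; last by lra.
  by rewrite /graph_len; have := ndx r T r0 rT; lra.
- move=> s s' s0 ss' s1.
  have vv : graph_arg x T s <= graph_arg x T s'.
    by rewrite lerD2l ler_pM2r.
  have v0 : x 0 <= graph_arg x T s by rewrite lerDl mulr_ge0// ltW.
  have /andP[] := entry_time_lip ndx vv.
  rewrite le_eqVlt => /predU1P[e _|lt _]; last by left.
  right; split=> //=; rewrite /graph_val /graph_time -e.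
  have := entry_time_left ndx v0; move: vv; set F := entry_time _ _ => vv h.
  rewrite ler0_norm; last by lra.
  by rewrite ler0_norm; lra.
Qed.

(** * Pointwise convergence and the M1-topology *)

Lemma rat_between (a b : R) : 0 <= a -> a < b ->
  exists q : rat, a < `|ratr q : R| < b.
Proof.
move=> a0 /rat_in_itvoo[q]; rewrite in_itv/= => /andP[aq qb].
by exists q; rewrite gtr0_norm ?aq//; exact: le_lt_trans aq.
Qed.

Section Convergence.
Variables (x_ : nat -> skorokhod R) (x : skorokhod R).
Hypotheses (ndx_ : forall n, nd_path (x_ n)) (ndx : nd_path x).
Hypothesis xq : forall q : rat,
  x_ n `|ratr q| @[n --> \oo] --> x `|ratr q|.

(** The defining inequality v < t + x t, tested at rationals slightly above
    and slightly below entry_time x v, is stable under convergence at these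
    points. *)
Lemma entry_time_cvg v : entry_time (x_ n) v @[n --> \oo] --> entry_time x v.
Proof.
apply/cvgrPdist_le => /= e e0; have F0 := entry_time_ge0 v ndx.
have /(rat_between F0)[q /andP[Fq qF]] : entry_time x v < entry_time x v + e.
  by lra.
have up : \forall n \near \oo, entry_time (x_ n) v <= `|ratr q|.
  have : v - `|ratr q| < x `|ratr q|.
    by have := entry_time_lt ndx Fq; lra.
  move=> /(cvgr_gt _ (@xq q)); apply: filterS => n ?.
  by apply: entry_time_le => //; lra.
have lo : \forall n \near \oo, entry_time x v - e <= entry_time (x_ n) v.
  have [Fe|eF] := leP (entry_time x v) e.
    by apply: nearW => n; have := entry_time_ge0 v (ndx_ n); lra.
  have /rat_between[|p /andP[Fp pF]] :
    entry_time x v - e < entry_time x v - e / 2 by lra.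
    by lra.
  have h : x `|ratr p| < v - `|ratr p|.
    have := @lt_entry_time x v (entry_time x v - e / 3) ndx.
    have := @ndx `|ratr p| (entry_time x v - e / 3) (normr_ge0 _).
    move=> h1 h2; have := h1 ltac:(lra).
    by have := h2 ltac:(lra) ltac:(lra); lra.
  move: h => /(cvgr_lt _ (@xq p)); apply: filterS => n ?.
  have : `|ratr p| <= entry_time (x_ n) v by apply: le_entry_time => //; lra.
  by lra.
by near do rewrite ler_norml; near=> n; apply/andP; split;
  [have : entry_time (x_ n) v <= `|ratr q| by near: n|
   have : entry_time x v - e <= entry_time (x_ n) v by near: n]; lra.
Unshelve. all: by end_near. Qed.

Lemma path_cvg0 : x_ n 0 @[n --> \oo] --> x 0.
Proof. by have := @xq 0; rewrite rmorph0 normr0. Qed.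

(** Monotonicity squeezes x_ n T between values at rationals on either side
    of T. *)
Lemma path_cvg_continuity T : 0 < T -> {for T, continuous x} ->
  x_ n T @[n --> \oo] --> x T.
Proof.
move=> T0 cT; apply/cvgrPdist_le => /= e e0.
have /cvgrPdist_lt/(_ _ e0) := cT.
move=> [d /= d0 dT].
have [|p /andP[Tp pT]] := @rat_between T (T + d) (ltW T0).
  by lra.
have [||q /andP[Tq qT]] := @rat_between (Num.max 0 (T - d)) T.
- by rewrite le_max lexx.
- by rewrite gt_max T0/=; lra.
have xp : x `|ratr p| < x T + e.
  have /= := dT `|ratr p| ltac:(rewrite /= ltr_norml; lra).
  by rewrite ltr_norml; lra.
have xq' : x T - e < x `|ratr q|.
  have h : T - d < `|ratr q| by move: Tq; rewrite gt_max => /andP[].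
  have /= := dT `|ratr q| ltac:(rewrite /= ltr_norml; lra).
  by rewrite ltr_norml; lra.
near=> n.
have h1 : x_ n `|ratr p| < x T + e.
  by near: n; exact: cvgr_lt xp.
have h2 : x T - e < x_ n `|ratr q|.
  by near: n; exact: cvgr_gt xq'.
have := ndx_ n (ltW T0) (ltW Tp); have := ndx_ n (normr_ge0 _) (ltW qT).
by rewrite ler_norml; lra.
Unshelve. all: by end_near. Qed.

(** Since all entry times are 1-Lipschitz, pointwise convergence on a grid
    of mesh e / 3 already controls the distance on the whole interval. *)
Lemma entry_time_ucvg a L e : 0 <= L -> 0 < e ->
  \forall n \near \oo, forall v, a <= v <= a + L ->
    `|entry_time (x_ n) v - entry_time x v| <= e.
Proof.
move=> L0 e0; pose N := (Num.truncn (L / (e / 3))).+1.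
pose g (i : nat) := a + i%:R * (e / 3).
have : \forall n \near \oo, forall i : 'I_N,
    `|entry_time x (g i) - entry_time (x_ n) (g i)| <= e / 3.
  apply: filter_forall => i; apply: cvgr_dist_le; last by lra.
  exact: entry_time_cvg.
apply: filterS => n H v /andP[av vL].
have e3 : 0 < e / 3 by lra.
have va0 : 0 <= (v - a) / (e / 3) by apply: divr_ge0; lra.
have iN : (Num.truncn ((v - a) / (e / 3)) < N)%N.
  rewrite ltnS; apply: le_truncn.
  by rewrite ler_pM2r ?invr_gt0//; lra.
have := H (Ordinal iN); rewrite /=; set i := Num.truncn _.
have /andP[h1 h2] : i%:R <= (v - a) / (e / 3) < i.+1%:R by exact: truncn_itv.
have {}h1 : g i <= v by move: h1; rewrite ler_pdivlMr// /g; lra.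
have {}h2 : v <= g i + e / 3.
  by move: h2; rewrite ltr_pdivrMr// -natr1 /g mulrDl; lra.
have := entry_time_dist v (g i) (ndx_ n).
have := entry_time_dist v (g i) ndx.
rewrite (ger0_norm (_ : 0 <= v - g i)); last by lra.
by rewrite !ler_norml; lra.
Qed.

Lemma graph_dist T (e : R) : 0 < T -> {for T, continuous x} -> 0 < e ->
  \forall n \near \oo, forall s, 0 <= s <= 1 ->
    `|graph_time (x_ n) T s - graph_time x T s| <= e /\
    `|graph_val (x_ n) T s - graph_val x T s| <= e.
Proof.
move=> T0 cT e0.
have L0 := ltW (graph_len_gt0 ndx T0); have e6 : 0 < e / 6 by lra.
have h0 : \forall n \near \oo, `|x 0 - x_ n 0| <= e / 6.
  by apply: cvgr_dist_le => //; exact: path_cvg0.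
have hT : \forall n \near \oo, `|x T - x_ n T| <= e / 6.
  by apply: cvgr_dist_le => //; exact: path_cvg_continuity.
have hF := @entry_time_ucvg (x 0) _ _ L0 e6.
apply: filterS3 h0 hT hF => n h0 hT hF s /andP[s0 s1].
have : `|graph_arg (x_ n) T s - graph_arg x T s| <= e / 3.
  have -> : graph_arg (x_ n) T s - graph_arg x T s =
    (1 - s) * (x_ n 0 - x 0) + s * (x_ n T - x T).
    by rewrite /graph_arg /graph_len; ring.
  move: h0 hT; rewrite !ler_norml => /andP[??] /andP[??].
  by apply/andP; split; nra.
have := entry_time_dist (graph_arg (x_ n) T s) (graph_arg x T s) (ndx_ n).
have := hF (graph_arg x T s).
rewrite lerDl lerD2l mulr_ge0//= -[leRHS]mul1r ler_wpM2r// => /(_ isT).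
rewrite /graph_val /graph_time.
set A := graph_arg _ _ _; set B := graph_arg _ _ _ => h1 h2 h3.
have {}h2 := le_trans h2 h3; move: h1 h2 h3; rewrite !ler_norml.
by move=> /andP[??] /andP[??] /andP[??]; split; lra.
Qed.

(** The continuity points T of the limit enter only through the convergence
    of the right end point T + x_ n T of the range of parameters. *)
Lemma nd_m1_cvg : m1_cvg x_ x.
Proof.
move=> T T0 cT.
have ge0 n : (0 <= m1_dist T (x_ n) x)%E.
  apply/ereal_infP => _ [u1 [r1 [u2 [r2 [_ _ ->]]]]].
  rewrite le_max; apply/orP; left.
  apply: (@le_trans _ _ `|u1 0 - u2 0|%:E); first by rewrite lee_fin.
  by apply: ereal_sup_ubound; exists 0 => //=; rewrite in_itv/= lexx ler01.
have le e : 0 < e -> \forall n \near \oo, (m1_dist T (x_ n) x <= e%:E)%E.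
  move=> e0; apply: filterS (graph_dist T0 cT e0) => n H.
  apply: ge_ereal_inf.
  exists (maxe (sup_dist01 (graph_val (x_ n) T) (graph_val x T))
               (sup_dist01 (graph_time (x_ n) T) (graph_time x T))).
    exists (graph_val (x_ n) T), (graph_time (x_ n) T).
    exists (graph_val x T), (graph_time x T).
    by split => //; exact: graph_param_rep.
  by rewrite ge_max; apply/andP; split; apply/ereal_supP => _ [s + <-];
    rewrite /= in_itv/= lee_fin => /H[].
apply/fine_cvgP; split.
  apply: filterS (le _ ltr01) => n h.
  by rewrite ge0_fin_numE// (le_lt_trans h)// ltry.
apply/cvgrPdist_le => /= e e0; apply: filterS (le _ e0) => n h.
rewrite sub0r normrN ger0_norm ?fine_ge0// -lee_fin fineK//.
by rewrite ge0_fin_numE// (le_lt_trans h)// ltry.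
Qed.

End Convergence.

(** The truth value of an inequality r <= f |q|, see lit_holds; the absolute
    value allows q to range over a countable type while times stay
    nonnegative. *)
Definition literal : Type := (rat * rat * bool)%type.

Definition lit_holds (f : R -> R) (c : literal) : bool :=
  (ratr c.1.2 <= f `|ratr c.1.1|) == c.2.

(** If no list of literals true for x works, there is for each n a
    nondecreasing path outside U that satisfies the first n literals true
    for x. These paths converge to x at all rational times, hence in M1, and
    yet avoid the open neighbourhood U of x. *)
Lemma open_literals (U : set (skorokhod R)) x : open U -> nd_path x -> U x ->
  exists s : seq literal, all (lit_holds x) s /\
    forall y, nd_path y -> all (lit_holds y) s -> U y.
Proof.
move=> oU ndx Ux; apply: contrapT => noU.
(* there are countably many literals, so each one is reached by some n *)
pose s n := [seq c <- pmap unpickle (iota 0 n) | lit_holds x c].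
have /choice[y_ y_P] : forall n, exists y, [/\ nd_path y,
    all (lit_holds y) (s n) & ~ U y].
  move=> n; apply: contrapT => noy; apply: noU; exists (s n); split.
    exact: filter_all.
  move=> y ndy ys; apply: contrapT => Uy; apply: noy; exists y; split => //.
have ev c : lit_holds x c -> \forall n \near \oo, lit_holds (y_ n) c.
  move=> xc; exists (pickle c).+1 => // n /= cn.
  have [_ /allP H _] := y_P n; apply: H.
  rewrite mem_filter xc mem_pmap/=; apply/mapP; exists (pickle c).
    by rewrite mem_iota.
  by rewrite pickleK.
have yx : m1_cvg y_ x.
  apply: nd_m1_cvg => // [n|q]; first by have [] := y_P n.
  set t := `|ratr q|; apply/cvgrPdist_le => /= e e0.
  have [p] := @rat_in_itvoo R (x t - e) (x t) ltac:(lra).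
  rewrite in_itv/= => /andP[px xp].
  have [r] := @rat_in_itvoo R (x t) (x t + e) ltac:(lra).
  rewrite in_itv/= => /andP[xr rx].
  have hp : lit_holds x (q, p, true) by rewrite /lit_holds/= (ltW xp).
  have hr : lit_holds x (q, r, false).
    by rewrite /lit_holds/= leNgt xr.
  apply: filterS2 (ev _ hp) (ev _ hr) => n.
  rewrite /lit_holds/= -/t => /eqP h1; rewrite eqbF_neg -ltNge => h2.
  by rewrite ler_norml; lra.
have [n _ /(_ n (leqnn n))/=] : \forall n \near \oo, U (y_ n).
  exact: (oU x y_ Ux yx).
by have [] := y_P n.
Qed.

End MonotoneM1.

(** * Processes of first exit form *)

Section ExitProcess.
Context d (Omega : measurableType d) (R : realType) (P : probability Omega R).

(** The points have heights h_k and dates c_k; for the passage times they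
    are the scaled perturbed walk and its clock, for the inverse extremal
    process the atoms of the Poisson random measure. *)
Definition first_exit (T : Type) (h c : nat -> T -> R) (w : T) (u : R) :
    \bar R :=
  ereal_inf [set (c k w)%:E | k in [set k | u < h k w]].

Lemma first_exit_geP (T : Type) (h c : nat -> T -> R) (w : T) (u : R)
    (y : \bar R) :
  (y <= first_exit h c w u)%E <-> forall k, u < h k w -> (y <= (c k w)%:E)%E.
Proof.
split=> [/ereal_infP H k uk|H]; first by apply: H; exists k.
by apply/ereal_infP => _ [k /= uk <-]; exact: H.
Qed.

(** The form in which the two processes of the theorem are recognized as
    first exits, without any case distinction on whether the infimum is
    attained. *)
Lemma first_exit_unique (T : Type) (h c : nat -> T -> R) (w : T) (u : R)
    (z : \bar R) :
  (forall y, (y <= z)%E <-> forall k, u < h k w -> (y <= (c k w)%:E)%E) ->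
  z = first_exit h c w u.
Proof.
move=> H; apply/eqP; rewrite eq_le; apply/andP; split.
  by apply/first_exit_geP; apply/H.
by apply/H; apply/first_exit_geP.
Qed.

Lemma first_exit_nd (T : Type) (h c : nat -> T -> R) (w : T) (u v : R) :
  u <= v -> (first_exit h c w u <= first_exit h c w v)%E.
Proof.
move=> uv; apply/first_exit_geP => k vk.
by apply: ereal_inf_lbound; exists k => //=; exact: le_lt_trans uv vk.
Qed.

Lemma measurable_first_exit (h c : nat -> Omega -> R) (a u : R) :
  (forall k, measurable_fun setT (h k)) ->
  (forall k, measurable_fun setT (c k)) ->
  measurable [set w | (a%:E <= first_exit h c w u)%E].
Proof.
move=> mh mc.
rewrite (_ : [set _ | _] = \bigcap_k
  (h k @^-1` `]-oo, u] `|` c k @^-1` `[a, +oo[)); last first.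
  apply/seteqP; split=> w /=.
    move=> /first_exit_geP H k _ /=; have [|/H] := leP (h k w) u.
      by move=> ?; left; rewrite in_itv.
    by rewrite lee_fin => ?; right; rewrite in_itv/= andbT.
  move=> H; apply/first_exit_geP => k uk; have [|] := H k I.
    by rewrite /= in_itv/= leNgt uk.
  by rewrite /= in_itv/= andbT lee_fin.
apply: bigcap_measurable => [|k _]; first by exists 0%N.
by apply: measurableU; rewrite -[X in measurable X]setTI;
  [exact: mh|exact: mc].
Qed.

Lemma first_exit_oo (T : Type) (h c : nat -> T -> R) (u : R) :
  (forall k w, 0 <= c k w) ->
  [set w | first_exit h c w u = +oo%E] =
  \bigcap_(n : nat) [set w | (n%:R%:E <= first_exit h c w u)%E].
Proof.
move=> c0; apply/seteqP; split=> w /=; first by move=> e n _; rewrite /= e leey.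
move=> H; apply/eqP/negPn/negP => Xoo.
have Xf : first_exit h c w u \is a fin_num.
  rewrite ge0_fin_numE ?ltey//; apply/first_exit_geP => k _.
  by rewrite lee_fin.
have := H (Num.truncn (fine (first_exit h c w u))).+1 I.
by rewrite /= -(fineK Xf) lee_fin leNgt truncnS_gt.
Qed.

(** The last clause makes almost all paths finite, hence elements of D. *)
Definition exit_process (h c : nat -> Omega -> R) : Prop :=
  [/\ forall k, measurable_fun setT (h k), forall k, measurable_fun setT (c k),
      forall k w, 0 <= c k w &
      forall u, 0 <= u -> P [set w | first_exit h c w u = +oo%E] = 0%E].

Variables h c : nat -> Omega -> R.
Hypothesis hc : exit_process h c.
Local Notation X := (first_exit h c).

Let measurable_ge (a u : R) : measurable [set w | (a%:E <= X w u)%E].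
Proof. by have [mh mc _ _] := hc; exact: measurable_first_exit. Qed.

Lemma first_exit_ge0 w u : (0 <= X w u)%E.
Proof.
by have [_ _ c0 _] := hc; apply/first_exit_geP => k _; rewrite lee_fin.
Qed.

Definition finite_paths : set Omega :=
  [set w | forall n : nat, (X w n%:R < +oo)%E].

Lemma finite_pathsP w u : finite_paths w -> X w u \is a fin_num.
Proof.
move=> Gw; rewrite ge0_fin_numE ?first_exit_ge0//.
apply: le_lt_trans (Gw (Num.truncn u).+1).
by apply: first_exit_nd; exact/ltW/truncnS_gt.
Qed.

(** A point with u < h k w still has this property for slightly larger u,
    which gives right continuity; the left limits come from monotonicity. *)
Lemma finite_paths_is_path w : finite_paths w -> exists x, is_path (X w) x.
Proof.
move=> Gw; pose f (u : R) : R := fine (X w (Num.max u 0)).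
have fE (u : R) : 0 <= u -> X w u = (f u)%:E.
  by move=> u0; rewrite /f max_l// fineK//; exact: finite_pathsP.
have ndf (s t : R) : s <= t -> f s <= f t.
  move=> st; apply: fine_le; [exact: finite_pathsP|exact: finite_pathsP|].
  by apply: first_exit_nd; rewrite ge_max !le_max st lexx orbT.
suff cf : is_cadlag f by exists (Skorokhod cf) => u /fE.
split=> t t0.
- apply/cvgrPdist_lt => /= e e0.
  have : (X w t < (f t + e)%:E)%E by rewrite fE// lte_fin; lra.
  move=> /ereal_inf_ltP[_ [k /= tk <-]]; rewrite lte_fin => ke.
  near=> s.
  have ts : t <= s by near: s; exact: nbhs_right_ge.
  have : ((f s)%:E <= (c k w)%:E)%E.
    rewrite -fE ?(le_trans t0 ts)//.
    by apply: ereal_inf_lbound; exists k => //=.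
  rewrite lee_fin; have := ndf t s ts.
  by rewrite ltr_norml; lra.
- apply: nondecreasing_at_left_is_cvgr.
    by apply: nearW => s x y _ _; exact: ndf.
  apply: nearW => s; exists (f t) => _ /= [r + <-].
  by rewrite in_itv/= => /andP[_ /ltW]; exact: ndf.
- by rewrite /f max_r ?ltW// max_l.
Unshelve. all: by end_near. Qed.

Lemma to_pathP w : finite_paths w -> is_path (X w) (to_path (X w)).
Proof. by move=> /finite_paths_is_path; exact: xgetPex. Qed.

Lemma to_pathN w : ~ finite_paths w -> to_path (X w) = point.
Proof.
move=> Gw; apply: xgetPN => x xX; apply: Gw => n.
by rewrite xX ?ltry.
Qed.

Lemma to_path_nd w : finite_paths w -> nd_path (to_path (X w)).
Proof.
move=> /to_pathP H s t s0 st.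
rewrite -lee_fin -(H _ s0) -(H _ (le_trans s0 st)).
exact: first_exit_nd.
Qed.

Lemma measurable_finite_paths : measurable finite_paths.
Proof.
rewrite (_ : finite_paths = \bigcap_n ~` [set w | X w n%:R = +oo%E]).
  apply: bigcap_measurable => [|k _]; first by exists 0%N.
  apply: measurableC; rewrite first_exit_oo; last by have [_ _ c0 _] := hc.
  apply: bigcap_measurable => [|n _]; first by exists 0%N.
  exact: measurable_ge.
apply/seteqP; split=> w /= H n.
  by move=> _ /=; have := H n; rewrite ltey => /eqP.
by rewrite ltey; apply/eqP; exact: H.
Qed.

Lemma finite_paths_full : P (~` finite_paths) = 0%E.
Proof.
have [_ _ _ Poo] := hc.
have mXn n : measurable [set w | X w n%:R = +oo%E].
  have [_ _ c0 _] := hc; rewrite first_exit_oo//.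
  apply: bigcap_measurable => [|k _]; first by exists 0%N.
  exact: measurable_ge.
apply/eqP; rewrite -measure_le0.
apply: (@le_trans _ _ (\sum_(n <oo) P [set w | X w n%:R = +oo%E])%E).
  apply: measure_sigma_subadditive => //.
    exact/measurableC/measurable_finite_paths.
  move=> w /existsNP[n /negP]; rewrite -leNgt leye_eq => /eqP Xn.
  by exists n.
by rewrite eseries0// => n _ _; exact: Poo.
Qed.

Definition cylinder (X : R -> \bar R) (s : seq literal) : bool :=
  all (fun c : literal => ((ratr c.1.2)%:E <= X `|ratr c.1.1|%R)%E == c.2) s.

Lemma cylinder_to_path w s : finite_paths w ->
  cylinder (X w) s = all (lit_holds (to_path (X w))) s.
Proof.
by move=> /to_pathP H; apply: eq_all => i; rewrite /lit_holds H// lee_fin.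
Qed.

Lemma measurable_cylinder s : measurable [set w | cylinder (X w) s].
Proof.
elim: s => [|[[q r] b] s IH].
  by rewrite (_ : [set _ | _] = setT)//; apply/seteqP; split.
rewrite (_ : [set _ | _] =
  [set w | ((ratr r)%:E <= X w `|ratr q|%R)%E == b] `&`
  [set w | cylinder (X w) s]); last first.
  by apply/seteqP; split=> w /= /andP.
apply: measurableI => //; have m := measurable_ge (ratr r) `|ratr q|.
case: b.
  rewrite (_ : [set _ | _] = [set w | ((ratr r)%:E <= X w `|ratr q|%R)%E])//.
  by apply/seteqP; split=> w /= /eqP.
rewrite (_ : [set _ | _] = ~` [set w | ((ratr r)%:E <= X w `|ratr q|%R)%E]).
  exact: measurableC.
by apply/seteqP; split=> w /=; rewrite eqbF_neg => /negP.
Qed.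

(** As n grows, the cylinders of these lists exhaust the nondecreasing paths
    of an open set U, by open_literals. *)
Definition inner_cylinders (U : set (skorokhod R)) (n : nat) :
    seq (seq literal) :=
  [seq s <- pmap unpickle (iota 0 n) |
    `[< forall y : skorokhod R, nd_path y -> all (lit_holds y) s -> U y >]].

Lemma measurable_has_cylinder (L : seq (seq literal)) :
  measurable [set w | has (cylinder (X w)) L].
Proof.
elim: L => [|s L IH].
  by rewrite (_ : [set _ | _] = set0)//; apply/seteqP; split.
rewrite (_ : [set _ | _] = [set w | cylinder (X w) s] `|`
  [set w | has (cylinder (X w)) L]).
  by apply: measurableU => //; exact: measurable_cylinder.
by apply/seteqP; split=> w /= /orP.
Qed.

Lemma inner_cylinders_nd U m n : (m <= n)%N ->
  {subset inner_cylinders U m <= inner_cylinders U n}.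
Proof.
move=> mn s; rewrite !mem_filter => /andP[-> /=].
rewrite !mem_pmap => /mapP[i im ->]; apply/mapP; exists i => //.
by move: im; rewrite !mem_iota !add0n => /leq_trans; exact.
Qed.

(** Paths that are infinite somewhere are all sent to the default path, so
    they lie in the preimage of U together or not at all. *)
Lemma to_path_openE (U : set (skorokhod R)) : open U ->
  [set w | U (to_path (X w))] =
  (finite_paths `&`
   \bigcup_n [set w | has (cylinder (X w)) (inner_cylinders U n)])
  `|` (~` finite_paths `&` [set _ | U point]).
Proof.
move=> oU; apply/seteqP; split=> w /=.
  move=> Uw; have [Gw|Gw] := pselect (finite_paths w); last first.
    by right; split => //; rewrite -(to_pathN Gw).
  left; split=> //.
  have [s [sw sU]] := open_literals oU (to_path_nd Gw) Uw.
  exists (pickle s).+1 => //=; apply/hasP; exists s.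
    rewrite mem_filter; apply/andP; split; first exact/asboolP.
    rewrite mem_pmap; apply/mapP; exists (pickle s); rewrite ?pickleK//.
    by rewrite mem_iota/= add0n.
  by rewrite cylinder_to_path.
move=> [[Gw [n _ /hasP[s]]]|[Gw]]; last by rewrite to_pathN.
rewrite mem_filter => /andP[/asboolP sU _]; rewrite cylinder_to_path//.
by apply: sU; exact: to_path_nd.
Qed.

Lemma measurable_bigcup_cylinders U : measurable
  (\bigcup_n [set w | has (cylinder (X w)) (inner_cylinders U n)]).
Proof.
by apply: bigcup_measurable => n _; exact: measurable_has_cylinder.
Qed.

Lemma measurable_to_path_open (U : set (skorokhod R)) : open U ->
  measurable [set w | U (to_path (X w))].
Proof.
move=> oU; rewrite to_path_openE//; apply: measurableU; apply: measurableI.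
- exact: measurable_finite_paths.
- exact: measurable_bigcup_cylinders.
- exact/measurableC/measurable_finite_paths.
- have [Up|Up] := pselect (U point).
    by rewrite (_ : [set _ | _] = setT)//; apply/seteqP; split.
  by rewrite (_ : [set _ | _] = set0)//; apply/seteqP; split.
Qed.

Lemma exit_random_path : random_path P X.
Proof.
split.
  exists (~` finite_paths); split.
  - exact/measurableC/measurable_finite_paths.
  - exact: finite_paths_full.
  - by move=> w /= H Gw; apply: H; exact: finite_paths_is_path.
have := @measurability _ _ Omega (g_sigma_algebraType (@open (skorokhod R)))
  setT (fun w => to_path (X w)) (@open (skorokhod R)) erefl.
apply => _ [U oU <-].
by rewrite setTI; exact: measurable_to_path_open.
Qed.

Lemma probability_to_path_open (U : set (skorokhod R)) : open U ->
  P [set w | U (to_path (X w))] =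
  P (\bigcup_n [set w | has (cylinder (X w)) (inner_cylinders U n)]).
Proof.
move=> oU; set A := \bigcup_n _.
have mA : measurable A by exact: measurable_bigcup_cylinders.
have mG := measurable_finite_paths; have PG := finite_paths_full.
have mE := measurable_to_path_open oU.
have PGI B : measurable B -> P B = P (B `&` finite_paths).
  move=> mB; have PB0 : P (B `&` ~` finite_paths) = 0%E.
    apply/eqP; rewrite -measure_le0 -PG le_measure ?inE//.
      by apply: measurableI => //; exact: measurableC.
    exact: measurableC.
  by rewrite {1}(measureDI P mB mG) setDE [X in (X + _)%E]PB0 add0e.
rewrite PGI// [RHS]PGI//; congr (P _); rewrite to_path_openE// -/A.
by apply/seteqP; split=> w /=; tauto.
Qed.

End ExitProcess.

(** * From finite-dimensional distributions to weak convergence *)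

(** The events that describe finite-dimensional distributions: they form a
    pi-system, as concatenation of lists is intersection. *)
Definition above (R : realType) (X : R -> \bar R) (s : seq (R * R)) : bool :=
  all (fun q => (q.2%:E <= X q.1)%E) s.

Lemma measurable_above (R : realType) d (T : measurableType d)
    (f g : nat -> T -> R) s :
  (forall k, measurable_fun setT (f k)) ->
  (forall k, measurable_fun setT (g k)) ->
  measurable [set w | above (first_exit f g w) s].
Proof.
move=> mf mg; elim: s => [|q s IH].
  by rewrite (_ : [set _ | _] = setT)//; apply/seteqP; split.
rewrite (_ : [set _ | _] = [set w | (q.2%:E <= first_exit f g w q.1)%E] `&`
   [set w | above (first_exit f g w) s]).
  by apply: measurableI => //; exact: measurable_first_exit.
by apply/seteqP; split=> w /= /andP.
Qed.

Section Portmanteau.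
Context d (Omega : measurableType d) (R : realType) (P : probability Omega R).
Context d' (Omega' : measurableType d') (P' : probability Omega' R).

(** This notion is compatible with differences and unions as soon as the
    intersections are under control, which is all that inclusion-exclusion
    needs. *)
Definition cvg_events (A : R -> set Omega) (B : set Omega') : Prop :=
  [/\ \forall t \near +oo, measurable (A t), measurable B &
      fine (P (A t)) @[t --> +oo] --> fine (P' B)].

Lemma fine_probabilityD d0 (T : measurableType d0) (Q : probability T R)
    (A B : set T) : measurable A -> measurable B ->
  fine (Q (A `\` B)) = fine (Q A) - fine (Q (A `&` B)).
Proof.
move=> mA mB; have mAB : measurable (A `&` B) by exact: measurableI.
rewrite measureD//; last by rewrite ltey_eq fin_num_measure.
by rewrite fineB ?fin_num_measure.
Qed.

Lemma fine_probabilityU d0 (T : measurableType d0) (Q : probability T R)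
    (A B : set T) : measurable A -> measurable B ->
  fine (Q (A `|` B)) = fine (Q A) + fine (Q B) - fine (Q (A `&` B)).
Proof.
move=> mA mB; have mAB : measurable (A `&` B) by exact: measurableI.
rewrite measureUfinl//; last by rewrite ltey_eq fin_num_measure.
rewrite fineB ?fineD ?fin_num_measure//.
by rewrite fin_numD !fin_num_measure.
Qed.

Lemma cvg_eventsD A C B D : cvg_events A B ->
  cvg_events (fun t => A t `&` C t) (B `&` D) ->
  (\forall t \near +oo, measurable (C t)) -> measurable D ->
  cvg_events (fun t => A t `\` C t) (B `\` D).
Proof.
move=> [mA mB AB] [mAC mBD ACBD] mC mD; split.
- by apply: filterS2 mA mC => t; exact: measurableD.
- exact: measurableD.
rewrite fine_probabilityD//.
apply: cvg_trans (cvgB AB ACBD); apply: near_eq_cvg.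
by apply: filterS2 mA mC => t mA mC; rewrite /= fine_probabilityD.
Qed.

Lemma cvg_eventsU A C B D : cvg_events A B -> cvg_events C D ->
  cvg_events (fun t => A t `&` C t) (B `&` D) ->
  cvg_events (fun t => A t `|` C t) (B `|` D).
Proof.
move=> [mA mB AB] [mC mD CD] [mAC mBD ACBD]; split.
- by apply: filterS2 mA mC => t; exact: measurableU.
- exact: measurableU.
rewrite fine_probabilityU//.
apply: cvg_trans (cvgB (cvgD AB CD) ACBD); apply: near_eq_cvg.
by apply: filterS2 mA mC => t mA mC; rewrite /= fine_probabilityU.
Qed.

Lemma cvg_events0 : cvg_events (fun=> set0) set0.
Proof.
split; [exact: nearW|exact: measurable0|].
by rewrite !measure0; exact: cvg_cst.
Qed.


Section Staircase.
Context d0 (T : measurableType d0) (Q : probability T R).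

Lemma bounded_integrable (Z : T -> R) (K : R) : measurable_fun setT Z ->
  (forall w, `|Z w| <= K) -> Q.-integrable setT (EFin \o Z).
Proof.
move=> mZ ZK; apply: measurable_bounded_integrable => //.
  by rewrite ltey_eq fin_num_measure.
exists K; split; first exact: num_real.
by move=> M KM w _; apply: le_trans (ZK w) _; exact: ltW.
Qed.

Lemma probability_Rintegral_cst (r : R) : (\int[Q]_w r)%R = r.
Proof.
rewrite Rintegral_cst//; transitivity (r * fine 1%E); last by rewrite mulr1.
by congr (_ * fine _); exact: probability_setT.
Qed.

(** A sum of indicators of open rays which is within e of y on a bounded
    range; it transfers bounds on the probabilities of open sets to
    expectations. *)
Definition staircase (e : R) (N : nat) (y : R) : R :=
  \sum_(i < N) e * (i.+1%:R * e < y)%R%:R.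

Lemma staircase_approx e N y : 0 < e -> 0 <= y <= N.+1%:R * e ->
  y - e <= staircase e N y <= y.
Proof.
move=> e0 /andP[y0 yN].
suff : (N%:R * e < y /\ staircase e N y = N%:R * e) \/
       (y <= N%:R * e /\ y - e <= staircase e N y <= y).
  by move: yN; rewrite -natr1 => yN [[? ->]|[]]//; lra.
elim: N {yN} => [|N IH]; rewrite /staircase ?big_ord0.
  by rewrite mul0r; have [?|?] := ltP 0 y; [left|right]; split => //; lra.
rewrite big_ord_recr/= -/(staircase e N y).
have [lt|ge] := ltP (N.+1%:R * e) y.
  left; split=> //; move: lt; rewrite mulr1 -natr1 => lt.
  by case: IH => [[_ ->]|[]]; lra.
right; split=> //; rewrite mulr0 addr0; move: ge; rewrite -natr1 => ge.
by case: IH => [[? ->]|[]]//; lra.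
Qed.

Lemma staircase_bound e N y : 0 < e -> `|staircase e N y| <= N%:R * e.
Proof.
move=> e0; rewrite ger0_norm; last first.
  by apply: sumr_ge0 => i _; rewrite mulr_ge0 ?ler0n// ltW.
have -> : N%:R * e = \sum_(i < N) e by rewrite sumr_const card_ord mulr_natl.
apply: ler_sum => i _; apply: ler_piMr; first exact: ltW.
by case: (_ < _); rewrite ?lexx ?ler01.
Qed.

Lemma measurable_gt_fun (Z : T -> R) a : measurable_fun setT Z ->
  measurable [set w | a < Z w].
Proof.
move=> mZ; rewrite (_ : [set _ | _] = setT `&` Z @^-1` `]a, +oo[).
  exact: mZ.
by rewrite setTI; apply/seteqP; split=> w /=; rewrite in_itv/= andbT.
Qed.

Lemma measurable_staircase e N (Z : T -> R) : measurable_fun setT Z ->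
  measurable_fun setT (fun w => staircase e N (Z w)).
Proof.
move=> mZ; apply: measurable_sum => i; apply: measurable_funM => //.
rewrite (_ : (fun _ => _) = \1_[set w | i.+1%:R * e < Z w]).
  by apply: measurable_indic; exact: measurable_gt_fun.
apply/funext => w; rewrite indicE; congr (_%:R); congr nat_of_bool.
by apply/idP/idP; rewrite inE.
Qed.

Lemma Rintegral_staircase e N (Z : T -> R) : 0 < e -> measurable_fun setT Z ->
  (\int[Q]_w staircase e N (Z w))%R =
  \sum_(i < N) e * fine (Q [set w | i.+1%:R * e < Z w]).
Proof.
move=> e0 mZ; elim: N => [|N IH].
  under eq_Rintegral do rewrite /staircase big_ord0.
  by rewrite big_ord0 probability_Rintegral_cst.
rewrite big_ord_recr/= -IH.
under eq_Rintegral do rewrite /staircase big_ord_recr/=.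
have mN := measurable_gt_fun (N.+1%:R * e) mZ.
have indE : (fun w => (N.+1%:R * e < Z w)%R%:R) =
    \1_[set w | N.+1%:R * e < Z w] :> (T -> R).
  apply/funext => w; rewrite indicE; congr (_%:R); congr nat_of_bool.
  by apply/idP/idP; rewrite inE.
have iN : Q.-integrable setT (EFin \o (fun w => (N.+1%:R * e < Z w)%R%:R)).
  apply: (@bounded_integrable _ 1); first by rewrite indE.
  by move=> w; case: (_ < _); rewrite ?normr1 ?normr0.
rewrite RintegralD//.
- congr (_ + _); rewrite RintegralZl//; congr (_ * _).
  by rewrite indE /Rintegral integral_indic// setIT.
- apply: (@bounded_integrable _ (N%:R * e)).
    exact: measurable_staircase.
  by move=> w; exact: staircase_bound.
- rewrite (_ : _ \o _ = (fun w =>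
    e%:E * (EFin \o (fun w => (N.+1%:R * e < Z w)%R%:R)) w)%E).
    exact: integrableZl.
  by apply/funext => w.
Qed.

End Staircase.

Variables (h c : R -> nat -> Omega -> R) (h' c' : nat -> Omega' -> R).
Hypothesis hc : \forall t \near +oo, exit_process P (h t) (c t).
Hypothesis hc' : exit_process P' h' c'.
Local Notation X t := (first_exit (h t) (c t)).
Local Notation Y := (first_exit h' c').

Hypothesis fdd : forall s : seq (R * R), all (fun q => 0 <= q.1) s ->
  fine (P [set w | above (X t w) s]) @[t --> +oo] -->
  fine (P' [set w | above (Y w) s]).

(** A negated inequality is removed by writing the event as a difference of
    two events with one negated inequality less. *)
Lemma cvg_events_cylinder s n : all (fun q : R * R => 0 <= q.1) s ->
  cvg_events (fun t => [set w | above (X t w) s && cylinder (X t w) n])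
    [set w | above (Y w) s && cylinder (Y w) n].
Proof.
elim: n s => [|[[q r] b] n IH] s s0.
  have E d0 (T : measurableType d0) (Z : T -> R -> \bar R) :
      [set w | above (Z w) s && cylinder (Z w) [::]] = [set w | above (Z w) s].
    by apply/seteqP; split=> w /=; rewrite andbT.
  rewrite E; split.
  - apply: filterS hc => t [mh mc _ _]; rewrite E; exact: measurable_above.
  - by have [mh mc _ _] := hc'; exact: measurable_above.
  - by under eq_fun do rewrite E; exact: fdd.
pose s' := (`|ratr q : R|, ratr r : R) :: s.
have s'0 : all (fun q : R * R => 0 <= q.1) s' by rewrite /= s0 normr_ge0.
have IHs' := IH _ s'0.
case: b.
  have E d0 (T : measurableType d0) (Z : T -> R -> \bar R) :
      [set w | above (Z w) s && cylinder (Z w) ((q, r, true) :: n)] =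
      [set w | above (Z w) s' && cylinder (Z w) n].
    by apply/seteqP; split=> w; rewrite /s' /cylinder /above /= eqb_id andbA
      (andbC (all _ s)).
  by rewrite E; under eq_fun do rewrite E.
pose N d0 (T : measurableType d0) (Z : T -> R -> \bar R) :=
  [set w | above (Z w) s' && cylinder (Z w) n].
have E d0 (T : measurableType d0) (Z : T -> R -> \bar R) :
    [set w | above (Z w) s && cylinder (Z w) ((q, r, false) :: n)] =
    [set w | above (Z w) s && cylinder (Z w) n] `\` N _ _ Z.
  apply/seteqP; split=> w; rewrite /N /s' /cylinder /above /= eqbF_neg.
    by move=> /andP[-> /andP[/negbTE -> ->]].
  by move=> [/andP[-> ->]]; rewrite !andbT => /negP ->.
have I d0 (T : measurableType d0) (Z : T -> R -> \bar R) :
    [set w | above (Z w) s && cylinder (Z w) n] `&` N _ _ Z = N _ _ Z.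
  rewrite setIC; apply/setIidPl => w; rewrite /N/= => /andP[/andP[_ h1] h2].
  by rewrite h2 andbT.
have [mN mN' _] := IHs'.
rewrite E; under eq_fun do rewrite E.
apply: cvg_eventsD => //; first exact: IH.
by rewrite I; under eq_fun do rewrite I.
Qed.

(** Inclusion-exclusion over the list of cylinders, whose pairwise
    intersections are again cylinders. *)
Lemma cvg_events_has_cylinder n (L : seq (seq literal)) :
  cvg_events (fun t => [set w | cylinder (X t w) n && has (cylinder (X t w)) L])
    [set w | cylinder (Y w) n && has (cylinder (Y w)) L].
Proof.
have cyl m : cvg_events (fun t => [set w | cylinder (X t w) m])
    [set w | cylinder (Y w) m] by exact: (@cvg_events_cylinder [::] m).
elim: L n => [|s L IH] n.
  have E d0 (T : measurableType d0) (Z : T -> R -> \bar R) :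
      [set w | cylinder (Z w) n && has (cylinder (Z w)) [::]] = set0.
    by apply/seteqP; split=> w //=; rewrite andbF.
  by rewrite E; under eq_fun do rewrite E; exact: cvg_events0.
have E d0 (T : measurableType d0) (Z : T -> R -> \bar R) :
    [set w | cylinder (Z w) n && has (cylinder (Z w)) (s :: L)] =
    [set w | cylinder (Z w) (n ++ s)] `|`
    [set w | cylinder (Z w) n && has (cylinder (Z w)) L].
  apply/seteqP; split=> w; rewrite /cylinder/= all_cat.
    by move=> /andP[-> /orP[->|->]]; [left|right].
  by move=> [/andP[-> ->]//|/andP[-> ->]]; rewrite orbT.
have I d0 (T : measurableType d0) (Z : T -> R -> \bar R) :
    [set w | cylinder (Z w) (n ++ s)] `&`
    [set w | cylinder (Z w) n && has (cylinder (Z w)) L] =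
    [set w | cylinder (Z w) (n ++ s) && has (cylinder (Z w)) L].
  apply/seteqP; split=> w; rewrite /cylinder/= all_cat.
    by move=> [/andP[-> ->] /andP[_ ->]].
  by move=> /andP[/andP[-> ->] ->].
rewrite E; under eq_fun do rewrite E.
apply: cvg_eventsU => //.
by rewrite I; under eq_fun do rewrite I; exact: IH.
Qed.

(** Finitely many inner cylinders carry the limit probability of U up to e /
    2, and the probability of their union converges. *)
Lemma open_liminf (U : set (skorokhod R)) (e : R) : open U -> 0 < e ->
  \forall t \near +oo, fine (P' [set w | U (to_path (Y w))]) - e <=
    fine (P [set w | U (to_path (X t w))]).
Proof.
move=> oU e0; pose A n := [set w | has (cylinder (Y w)) (inner_cylinders U n)].
have mA n : measurable (A n) by exact: measurable_has_cylinder hc' _.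
have ndA : nondecreasing_seq A.
  move=> m n mn; apply/subsetPset => w /hasP[s sm sw]; apply/hasP.
  by exists s => //; exact: inner_cylinders_nd mn _ sm.
have mUA : measurable (\bigcup_n A n) by exact: bigcup_measurable.
have : P' (A n) @[n --> \oo] --> P' [set w | U (to_path (Y w))].
  rewrite (probability_to_path_open hc' oU).
  exact: nondecreasing_cvg_mu mA mUA ndA.
have mU := measurable_to_path_open hc' oU.
rewrite -[Z in _ --> Z](@fineK _ (P' _)) ?fin_num_measure//.
move=> /fine_cvgP[_]/cvgrPdist_le/(_ (e / 2))/(_ ltac:(lra)).
move=> [n _]/(_ n (leqnn n)).
rewrite /= ler_norml => /andP[_ hn].
have [_ _] := cvg_events_has_cylinder [::] (inner_cylinders U n).
move=> /cvgrPdist_le/(_ (e / 2))/(_ ltac:(lra)).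
apply: filterS2 hc => t ht; rewrite /= ler_norml => /andP[_ hn'].
have mUt := measurable_to_path_open ht oU.
rewrite (probability_to_path_open ht oU).
have : fine (P [set w | has (cylinder (X t w)) (inner_cylinders U n)]) <=
   fine (P (\bigcup_n [set w | has (cylinder (X t w)) (inner_cylinders U n)])).
  have m1 := measurable_has_cylinder ht (inner_cylinders U n).
  have m2 := measurable_bigcup_cylinders ht U.
  apply: fine_le; rewrite ?fin_num_measure//.
  by apply: le_measure; rewrite ?inE// => w ?; exists n.
by rewrite /A in hn; lra.
Qed.

Lemma measurable_continuous_path d0 (T : measurableType d0)
    (Q : probability T R) (f g : nat -> T -> R) (phi : skorokhod R -> R) :
  exit_process Q f g -> continuous phi ->
  measurable_fun setT (fun w => phi (to_path (first_exit f g w))).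
Proof.
move=> fg cphi; apply: (measurability _ (RGenOInfty.measurableE R)).
move=> _ [_ [a ->] <-]; rewrite setTI.
have := @measurable_to_path_open _ _ _ _ _ _ fg (phi @^-1` `]a, +oo[).
apply; move/continuousP : cphi; apply; exact: interval_open.
Qed.

(** The sets where phi exceeds a given number are open, so open_liminf
    bounds the expectation of a staircase approximation of phi from below. *)
Lemma expectation_liminf (phi : skorokhod R -> R) (K e : R) :
  continuous phi -> (forall x, 0 <= phi x <= K) -> 0 < e ->
  \forall t \near +oo,
    (\int[P']_w phi (to_path (Y w)))%R - e <=
    (\int[P]_w phi (to_path (X t w)))%R.
Proof.
move=> cphi phiK e0; pose N := (Num.truncn (K / (e / 2))).
have e2 : 0 < e / 2 by lra.
have KN : K <= N.+1%:R * (e / 2).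
  by rewrite -ler_pdivrMr//; exact/ltW/truncnS_gt.
have phiKn x : `|phi x| <= K.
  by have /andP[? ?] := phiK x; rewrite ger0_norm.
have appr x : phi x - e / 2 <= staircase (e / 2) N (phi x) <= phi x.
  apply: staircase_approx => //; have /andP[-> /=] := phiK x.
  by move=> /le_trans; exact.
(* each of the N steps of height e / 2 may lose this much probability, so
   that the staircase loses at most e / 2 altogether *)
have e4 : 0 < (e / 2) / (N.+1%:R * (e / 2)) by rewrite divr_gt0// mulr_gt0.
have : \forall t \near +oo, forall i : 'I_N,
    fine (P' [set w | i.+1%:R * (e / 2) < phi (to_path (Y w))]) -
      (e / 2) / (N.+1%:R * (e / 2)) <=
    fine (P [set w | i.+1%:R * (e / 2) < phi (to_path (X t w))]).
  apply: filter_forall => i.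
  apply: (open_liminf (U := phi @^-1` [set y | i.+1%:R * (e / 2) < y])) => //.
  by move/continuousP : cphi; apply; exact: open_gt.
apply: filterS2 hc => t ht Ht.
have mX := measurable_continuous_path ht cphi.
have mY := measurable_continuous_path hc' cphi.
have iX := bounded_integrable P mX (fun w => phiKn _).
have iY := bounded_integrable P' mY (fun w => phiKn _).
have isX := bounded_integrable P (measurable_staircase (e / 2) N mX)
  (fun w => staircase_bound _ _ e2).
have isY := bounded_integrable P' (measurable_staircase (e / 2) N mY)
  (fun w => staircase_bound _ _ e2).
have : (\int[P]_w staircase (e / 2) N (phi (to_path (X t w))))%R <=
       (\int[P]_w phi (to_path (X t w)))%R.
  by apply: le_Rintegral => // w _; have /andP[] := appr (to_path (X t w)).
have : (\int[P']_w phi (to_path (Y w)))%R <=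
  (\int[P']_w (staircase (e / 2) N (phi (to_path (Y w))) + e / 2))%R.
  apply: le_Rintegral => //.
    apply: (@bounded_integrable _ _ _ _ (N%:R * (e / 2) + e / 2)).
      by apply: measurable_funD => //; exact: measurable_staircase.
    move=> w; rewrite (le_trans (ler_normD _ _))// lerD ?staircase_bound//.
    by rewrite ger0_norm// ltW.
  by move=> w _; have /andP[] := appr (to_path (Y w)); lra.
rewrite RintegralD//; last first.
  by apply: (@bounded_integrable _ _ _ _ `|e / 2|).
rewrite probability_Rintegral_cst !Rintegral_staircase//.
pose p' i := fine (P' [set w | i.+1%:R * (e / 2) < phi (to_path (Y w))]).
pose p i := fine (P [set w | i.+1%:R * (e / 2) < phi (to_path (X t w))]).
rewrite -/(\sum_(i < N) e / 2 * p' i) -/(\sum_(i < N) e / 2 * p i).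
have : \sum_(i < N) e / 2 * p' i - e / 2 <= \sum_(i < N) e / 2 * p i.
  rewrite lerBlDr.
  apply: (@le_trans _ _ (\sum_(i < N) (e / 2 * p i + e / 2 / N.+1%:R))).
    apply: ler_sum => i _; rewrite -lerBlDr.
    apply: le_trans (ler_wpM2l (ltW e2) (Ht i)).
    suff -> : e / 2 / N.+1%:R = e / 2 * (e / 2 / (N.+1%:R * (e / 2))).
      by rewrite -mulrBr.
    have : N.+1%:R != 0 :> R by rewrite pnatr_eq0.
    by move: (N.+1%:R : R) => n n0; field; rewrite n0 gt_eqF.
  rewrite big_split/= lerD2l sumr_const card_ord -[leLHS]mulr_natr.
  by rewrite -mulrA ler_piMr ?(ltW e2)// mulrC ler_pdivrMr// mul1r ler_nat.
by lra.
Qed.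

Lemma expectationE d0 (T : measurableType d0) (Q : probability T R) (Z : T -> R)
    (K : R) : measurable_fun setT Z -> (forall w, `|Z w| <= K) ->
  'E_Q[Z]%E = (\int[Q]_w Z w)%R%:E.
Proof.
move=> mZ ZK; rewrite unlock /Rintegral fineK//.
by apply: integrable_fin_num => //; exact: bounded_integrable ZK.
Qed.

(** If M bounds the modulus of phi, then expectation_liminf applied to phi +
    M and to M - phi yields the two inequalities of the limit. *)
Theorem fdd_cvg_law_M1 : cvg_law_M1 P P' (fun t => X t) Y.
Proof.
split; first by apply: filterS hc => t; exact: exit_random_path.
  exact: exit_random_path hc'.
move=> phi cphi [M phiM].
have mY := measurable_continuous_path hc' cphi.
have M1 : 0 <= M := le_trans (normr_ge0 _) (phiM point).
have bd x : - M <= phi x <= M by rewrite -ler_norml.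
rewrite (expectationE P' mY (fun w => phiM _)).
apply: cvg_trans
  (_ : (\int[P]_w phi (to_path (X t w)))%R%:E @[t --> +oo] --> _).
  apply: near_eq_cvg; apply: filterS hc => t ht.
  rewrite (expectationE P _ (fun w => phiM _))//.
  exact: measurable_continuous_path ht cphi.
apply: cvg_EFin; first exact: nearW.
apply/cvgrPdist_le => /= e e0.
have cadd (T : topologicalType) (f : T -> R) :
    continuous f -> continuous (fun x => f x + M).
  by move=> cf x; apply: cvgD; [exact: cf|exact: cvg_cst].
have csub (T : topologicalType) (f : T -> R) :
    continuous f -> continuous (fun x => M - f x).
  by move=> cf x; apply: cvgB; [exact: cvg_cst|exact: cf].
have cp := cadd _ _ cphi; have cm := csub _ _ cphi.
have bp x : 0 <= phi x + M <= 2 * M by have := bd x; lra.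
have bm x : 0 <= M - phi x <= 2 * M by have := bd x; lra.
apply: filterS3 hc (expectation_liminf cp bp e0) (expectation_liminf cm bm e0).
move=> t ht.
have mX := measurable_continuous_path ht cphi.
have iX := bounded_integrable P mX (fun w => phiM _).
have iY := bounded_integrable P' mY (fun w => phiM _).
have ic d0 (T : measurableType d0) (Q : probability T R) :
  Q.-integrable setT (EFin \o (fun=> M)).
  by apply: (@bounded_integrable _ _ _ _ `|M|).
have icX := ic _ _ P; have icY := ic _ _ P'.
have := RintegralD measurableT iX icX; have := RintegralD measurableT iY icY.
have := RintegralB measurableT icX iX; have := RintegralB measurableT icY iY.
rewrite /= !probability_Rintegral_cst => -> -> -> ->.
by rewrite ler_norml; lra.
Qed.

End Portmanteau.

(** * Regularly varying tails *)

Section Asymptotics.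
Variable R : realType.

Lemma powR_shift_cvg (u p : R) : 0 < u -> (u + e) `^ p @[e --> 0] --> u `^ p.
Proof.
move=> u0; rewrite {2}/powR gt_eqF//.
have ul : u + e @[e --> (0 : R)] --> u.
  by rewrite -[X in _ --> X]addr0; apply: cvgD; [exact: cvg_cst|exact: cvg_id].
have ll : ln (u + e) @[e --> (0 : R)] --> ln u.
  by apply: (cvg_comp _ _ ul); exact: continuous_ln.
have el : expR (p * ln (u + e)) @[e --> (0 : R)] --> expR (p * ln u).
  apply: (@cvg_comp _ _ _ (fun e => p * ln (u + e)) expR _ (nbhs (p * ln u))).
    by apply: cvgM => //; exact: cvg_cst.
  exact: continuous_expR.
apply: cvg_trans el; apply: near_eq_cvg; near=> e; rewrite /powR gt_eqF//.
by near: e; exists u => //= e /=; rewrite ltr_norml; lra.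
Unshelve. all: by end_near. Qed.

(** Squeezed between powers, by exp(- q / (1 - q)) <= 1 - q <= exp(- q). *)
Lemma compound_cvg (F : set_system R) (FF : ProperFilter F) (q : R -> R)
    (n : R -> nat) (lam : R) :
  (\forall t \near F, 0 <= q t) -> q t @[t --> F] --> (0 : R) ->
  (n t)%:R * q t @[t --> F] --> lam ->
  (1 - q t) ^+ (n t) @[t --> F] --> expR (- lam).
Proof.
move=> q0 qF nq.
have q1 : \forall t \near F, q t < 1.
  by apply: cvgr_lt; [exact: qF|exact: ltr01].
have lo : expR (- ((n t)%:R * q t / (1 - q t))) @[t --> F] --> expR (- lam).
  apply: (@cvg_comp _ _ _ (fun t => - ((n t)%:R * q t / (1 - q t))) expR _
    (nbhs (- lam))); last exact: continuous_expR.
  apply: cvgN; rewrite -[X in _ --> X]divr1; apply: cvgM => //.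
  apply: cvgV; first by rewrite oner_neq0.
  by rewrite -[X in _ --> X]subr0; apply: cvgB => //; exact: cvg_cst.
have up : expR (- ((n t)%:R * q t)) @[t --> F] --> expR (- lam).
  apply: (@cvg_comp _ _ _ (fun t => - ((n t)%:R * q t)) expR _
    (nbhs (- lam))); last exact: continuous_expR.
  exact: cvgN.
apply: squeeze_cvgr lo up.
apply: filterS2 q0 q1 => t q0 q1; apply/andP; split.
  have -> : - ((n t)%:R * q t / (1 - q t)) = (n t)%:R * - (q t / (1 - q t)).
    by rewrite mulrN mulrA.
  rewrite expRM_natl; apply: lerXn2r; rewrite ?nnegrE ?expR_ge0//; first by lra.
  have := expR_ge1Dx (q t / (1 - q t)).
  have -> : 1 + q t / (1 - q t) = (1 - q t)^-1 by field; lra.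
  rewrite expRN -[X in _ -> _ <= X]invrK lef_pV2// posrE ?invr_gt0 ?expR_gt0//.
  by lra.
rewrite -mulrN expRM_natl.
apply: lerXn2r; rewrite ?nnegrE ?expR_ge0//; first by lra.
by have := expR_ge1Dx (- q t).
Qed.

(** The number of k : nat with k + 1 < y, see nbelowP. *)
Definition nbelow (y : R) : nat := (`|Num.ceil y|%N).-1.

Lemma nbelowP (y : R) k : 0 <= y -> (k < nbelow y)%N = (k.+1%:R < y).
Proof.
move=> y0; have c0 : 0 <= Num.ceil y by rewrite ceil_ge0; lra.
rewrite /nbelow -[RHS](ceil_gt_int _ k.+1) -{2}(gez0_abs c0) ltz_nat.
by case: `|_|%N.
Qed.

Lemma nbelow_le (x y : R) : 0 <= x -> x <= y -> (nbelow x <= nbelow y)%N.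
Proof.
move=> x0 xy; have y0 := le_trans x0 xy.
rewrite leqNgt nbelowP//; apply/negP => h.
by have := ltnn (nbelow y); rewrite (nbelowP _ y0) (lt_le_trans h).
Qed.

Lemma nbelow_bounds (y : R) : 0 <= y -> y - 1 <= (nbelow y)%:R <= y.
Proof.
move=> y0; apply/andP; split.
  have := ltnn (nbelow y); rewrite (nbelowP _ y0) => /negbT.
  by rewrite -leNgt -natr1; lra.
case E : (nbelow y) => [//|k].
by apply/ltW; rewrite -(nbelowP _ y0) E.
Qed.

Lemma nbelow_cvg (F : set_system R) (FF : ProperFilter F) (a : R -> R) (x : R) :
  0 <= x -> (\forall t \near F, 0 < a t) -> a t @[t --> F] --> (0 : R) ->
  (nbelow (x / a t))%:R * a t @[t --> F] --> x.
Proof.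
move=> x0 a0 aF.
have lo : x - a t @[t --> F] --> x.
  by rewrite -[X in _ --> X]subr0; apply: cvgB => //; exact: cvg_cst.
apply: (squeeze_cvgr _ lo (cvg_cst x)); apply: filterS a0 => t a0.
have /nbelow_bounds/andP[h1 h2] : 0 <= x / a t by rewrite divr_ge0// ltW.
have := ler_wpM2r (ltW a0) h1; rewrite mulrBl divfK ?gt_eqF// mul1r => -> /=.
by rewrite -ler_pdivlMr.
Qed.

End Asymptotics.

Section RegularVariation.
Variable R : realType.
Variables (a : R -> R) (alpha : R) (l : R -> R).
Hypothesis alpha01 : 0 < alpha < 1.
Hypothesis a_ge0 : forall t, 0 <= a t.
Hypothesis a_ni : forall s t, s <= t -> a t <= a s.
Hypothesis l_sv : slowly_varying l.
Hypothesis al : a x / (x `^ (- alpha) * l x) @[x --> +oo] --> (1 : R).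

Lemma regvar_gt0 : \forall t \near +oo, 0 < a t.
Proof.
have : \forall t \near +oo, 0 < a t / (t `^ (- alpha) * l t).
  by apply: cvgr_gt; [exact: al|exact: ltr01].
apply: filterS => t h; rewrite lt0r a_ge0 andbT.
by apply: contraTneq h => ->; rewrite mul0r ltxx.
Qed.

(** The slowly varying factor disappears in the ratio. *)
Lemma regvar_ratio u : 0 < u -> a (u * t) / a t @[t --> +oo] --> u `^ (- alpha).
Proof.
move=> u0; have [[A [_ lA]] lc] := l_sv.
have uoo : u * t @[t --> +oo] --> +oo by apply: gt0_cvgMry => //; exact: cvg_id.
pose r x := a x / (x `^ (- alpha) * l x).
have ru : r (u * t) @[t --> +oo] --> (1 : R).
  exact: cvg_comp uoo al.
have rr : r (u * t) / r t * (l (u * t) / l t) * u `^ (- alpha) @[t --> +oo] -->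
    u `^ (- alpha).
  rewrite -[X in _ --> X]mul1r; apply: cvgM; last exact: cvg_cst.
  rewrite -[X in _ --> X]mul1r; apply: cvgM; last exact: lc.
  rewrite -[X in _ --> X]divr1; apply: cvgM => //.
  by apply: cvgV => //; rewrite oner_neq0.
apply: cvg_trans rr; apply: near_eq_cvg.
have lt : \forall t \near +oo, 0 < l t.
  by exists A; split; [exact: num_real|exact: lA].
have lut : \forall t \near +oo, 0 < l (u * t) by exact: uoo _ lt.
have t0 : \forall t \near +oo, (0 : R) < t by exists 0; split.
apply: filterS3 regvar_gt0 t0 (filterI lt lut) => t at0 t0 [lt0 lut0].
rewrite /r powRM ?(ltW u0) ?(ltW t0)//.
have p1 : 0 < u `^ (- alpha) by exact: powR_gt0.
have p2 : 0 < t `^ (- alpha) by exact: powR_gt0.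
by field; rewrite !gt_eqF.
Qed.

Lemma bernoulli k (r : R) : 1 <= r -> 1 + k%:R * (r - 1) <= r ^+ k.
Proof.
move=> r1; elim: k => [|k IH]; first by rewrite mul0r expr0 addr0.
have k0 : 0 <= k%:R * ((r - 1) * (r - 1)) by rewrite !mulr_ge0 ?ler0n; lra.
have := @ler_wpM2l _ r ltac:(lra) _ _ IH.
by rewrite exprS -natr1; lra.
Qed.

(** Doubling t multiplies t a(t) by almost 2^(1 - alpha) > 1, so t a(t)
    grows geometrically along the powers of 2; monotonicity of a fills the
    gaps. *)
Lemma regvar_mul_pinfty : t * a t @[t --> +oo] --> +oo.
Proof.
have /andP[a0 a1] := alpha01.
pose rho : R := 2 `^ (1 - alpha).
have rho1 : 1 < rho.
  have {1}<- : 1 `^ (1 - alpha) = 1 :> R by rewrite powR1.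
  by apply: gt0_ltr_powR; rewrite ?nnegrE//; lra.
(* a growth factor strictly between 1 and rho, attained from some point on *)
pose r := (1 + rho) / 2.
have r1 : 1 < r by rewrite /r; lra.
have : \forall t \near +oo, r / 2 < a (2 * t) / a t.
  apply: (cvgr_gt _ (@regvar_ratio 2 _)) => //.
  rewrite ltr_pdivrMr//.
  have -> : 2 `^ (- alpha) * 2 = rho.
    by rewrite /rho powRD ?powRr1 1?mulrC// pnatr_eq0 implybT.
  by rewrite /r; lra.
move=> H; have := filterI H regvar_gt0 => -[A [_ HA]].
pose t0 := Num.max A 0 + 1.
have At0 : A < t0 by rewrite /t0 ltr_pwDr// le_max lexx.
have t00 : 0 < t0 by rewrite /t0 ltr_pwDr// le_max lexx orbT.
have step k : r ^+ k * (t0 * a t0) <= (2 ^+ k * t0) * a (2 ^+ k * t0).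
  elim: k => [|k IH]; first by rewrite !expr0 !mul1r.
  have Ak : A < 2 ^+ k * t0.
    apply: lt_le_trans At0 _; apply: ler_peMl; first exact: ltW.
    by apply: exprn_ege1; rewrite ler1n.
  have [+ ak] := HA _ Ak; rewrite ltr_pdivlMr// => h.
  rewrite exprS -mulrA (le_trans (ler_wpM2l _ IH))//; first by lra.
  have x0 : 0 <= 2 ^+ k * t0 by rewrite mulr_ge0 ?exprn_ge0// ltW.
  rewrite exprS -(mulrA 2); move: (2 ^+ k * t0) x0 h => x x0 h.
  by have := ler_wpM2l x0 (ltW h); lra.
have c0 : 0 < r * (t0 * a t0) / 2.
  by rewrite divr_gt0// mulr_gt0 ?mulr_gt0//; [lra|have [] := HA _ At0].
apply/cvgryPge => M.
have [K MK] : exists K, M <= r ^+ K * (r * (t0 * a t0) / 2).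
  set c := r * _ / 2 in c0 *.
  exists (Num.truncn (M / (c * (r - 1)))).+1.
  set K := _.+1.
  have h : M <= K%:R * (c * (r - 1)).
    have cr : 0 < c * (r - 1) by apply: mulr_gt0 => //; lra.
    by rewrite -ler_pdivrMr//; exact/ltW/truncnS_gt.
  have := ler_wpM2r (ltW c0) (bernoulli K (ltW r1)).
  move: (K%:R : R) (r ^+ K) h => n rn h; rewrite mulrDl mul1r -mulrA.
  rewrite (mulrC _ c) => /(le_trans _); apply.
  by rewrite (le_trans h)// lerDr ltW.
exists (2 ^+ K * t0); split; first exact: num_real.
move=> t Kt; pose n := Num.truncn (t / t0); pose k := trunc_log 2 n.
have tt0 : 2 ^+ K <= t / t0 by rewrite ler_pdivlMr// ltW.
have tt00 : 0 <= t / t0 by rewrite (le_trans _ tt0)// exprn_ge0.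
have Kn : (2 ^ K <= n)%N.
  by rewrite /n truncn_ge_nat// natrX.
have n0 : (0 < n)%N by rewrite (leq_trans _ Kn)// expn_gt0.
have /andP[kn nk] := trunc_log_bounds (ltnSn 1) n0.
have Kk : (K <= k)%N by apply: trunc_log_max.
have /andP[nt tn] := truncn_itv tt00.
have lo : 2 ^+ k * t0 <= t.
  by rewrite -ler_pdivlMr// (le_trans _ nt)// -natrX ler_nat.
have up : t <= 2 ^+ k.+1 * t0.
  by rewrite -ler_pdivrMr// (le_trans (ltW tn))// -natrX ler_nat.
apply: le_trans MK _.
apply: (@le_trans _ _ (r ^+ k * (r * (t0 * a t0) / 2))).
  by rewrite ler_wpM2r// ?(ltW c0)// ler_weXn2l// ltW.
have := step k.+1; have := a_ni up; have := a_ge0 (2 ^+ k.+1 * t0).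
rewrite !exprS -!(mulrA 2) => h1 h2 h3.
set x := 2 ^+ k * t0 in lo up h1 h2 h3; set y := a _ in h1 h2 h3.
have -> : r ^+ k * (r * (t0 * a t0) / 2) = (r * r ^+ k * (t0 * a t0)) / 2.
  by ring.
have x0 : 0 <= x by rewrite mulr_ge0 ?exprn_ge0// ltW.
by have := ler_pM x0 h1 lo h2; lra.
Qed.

End RegularVariation.

(** * Staircase regions and their mean measure *)

Section Staircases.
Variables (R : realType) (alpha : R).
Implicit Types (s : seq (R * R)) (q : R * R).

(** As long as several constraints are active, they amount to the one with
    the lowest level; lists are sorted by date only, hence the minimum. *)
Definition lowest (u : R) s : R := foldr (fun q m => Num.min q.1 m) u s.

Lemma lowest_lt u s y :
  (lowest u s < y) = (u < y) || has (fun q => q.1 < y) s.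
Proof. by elim: s => [|q s IH]/=; rewrite ?orbF// gt_min IH orbCA. Qed.

Lemma lowest_ge u s y :
  (y <= lowest u s) = (y <= u) && all (fun q => y <= q.1) s.
Proof. by elim: s => [|q s IH]/=; rewrite ?andbT// le_min IH andbCA. Qed.

Lemma lowest_gt u s y :
  (y < lowest u s) = (y < u) && all (fun q => y < q.1) s.
Proof. by elim: s => [|q s IH]/=; rewrite ?andbT// lt_min IH andbCA. Qed.

Definition shift_levels (e : R) s := [seq (q.1 + e, q.2) | q <- s].

Lemma lowest_shift u s e : lowest (u + e) (shift_levels e s) = lowest u s + e.
Proof. by elim: s => [//|q s IH]/=; rewrite IH addr_minl. Qed.

(** The mean measure of region x0 s, see mean_measure_region; also the limit
    of - ln of the probability of the same constraints on the perturbations. *)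
Fixpoint exponent (x0 : R) s : R :=
  if s is q :: s' then
    (q.2 - x0) * lowest q.1 s' `^ (- alpha) + exponent q.2 s'
  else 0.

(** Continuity in the levels absorbs the displacement of order o(t) that the
    walk adds to the perturbations. *)
Lemma exponent_shift_cvg x0 s : all (fun q => 0 < q.1) s ->
  exponent x0 (shift_levels e s) @[e --> 0] --> exponent x0 s.
Proof.
elim: s x0 => [|q s IH] x0 /=; first by move=> _; exact: cvg_cst.
move=> /andP[q0 s0]; apply: cvgD; last exact: IH.
apply: cvgM; first exact: cvg_cst.
under eq_fun do rewrite lowest_shift.
by apply: powR_shift_cvg; rewrite lowest_gt q0 s0.
Qed.

Definition later (q q' : R * R) := q.2 <= q'.2.

Lemma later_trans : transitive later.
Proof. by move=> p q r; exact: le_trans. Qed.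

Lemma path_later q s : path later q s -> all (later q) s.
Proof. exact/order_path_min/later_trans. Qed.

(** The pairs (date, height) of points whose absence expresses the
    constraints of s from time x0 on. *)
Definition region (x0 : R) s : set (R * R) :=
  [set z | has (fun q => (x0 <= z.1 < q.2) && (q.1 < z.2)) s].

(** Before the date q.2 all constraints are active and only the lowest level
    matters; from then on q has expired. *)
Lemma region_cons x0 q s : x0 <= q.2 -> path later q s ->
  region x0 (q :: s) =
  (`[x0, q.2[%classic `*` `]lowest q.1 s, +oo[%classic) `|` region q.2 s.
Proof.
move=> xq /path_later/allP qs; apply/seteqP; split=> -[x y].
  move=> /=/orP[/andP[h1 h2]|/hasP[p ps /andP[/andP[h1 h2] h3]]].
    by left; rewrite /= !in_itv/= h1 lowest_lt h2.
  have [xq2|xq2] := ltP x q.2; last first.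
    by right; apply/hasP; exists p => //=; rewrite xq2 h2.
  left; rewrite /= !in_itv/= h1 xq2 lowest_lt; split => //; rewrite andbT.
  by apply/orP; right; apply/hasP; exists p.
move=> [|/hasP[p ps /=/andP[/andP[h1 h2] h3]]].
  rewrite /= !in_itv/= => -[/andP[h1 h2]]; rewrite andbT lowest_lt /region/=.
  move=> /orP[h3|/hasP[p ps h3]]; first by rewrite h1 h2 h3.
  apply/orP; right; apply/hasP; exists p => //.
  by rewrite h1 h3 andbT/= (lt_le_trans h2)//; exact: qs.
rewrite /region/=; apply/orP; right; apply/hasP; exists p => //=.
by rewrite (le_trans xq h1) h2 h3.
Qed.

Lemma measurable_box (a b u : R) :
  measurable (`[a, b[%classic `*` `]u, +oo[%classic : set (R * R)).
Proof. by apply: measurableX; exact: measurable_itv. Qed.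

Lemma measurable_region x0 s : measurable (region x0 s).
Proof.
elim: s => [|q s IH].
  by rewrite (_ : region _ _ = set0)//; apply/seteqP; split.
rewrite (_ : region _ _ = (`[x0, q.2[%classic `*` `]q.1, +oo[%classic) `|`
  region x0 s).
  by apply: measurableU => //; exact: measurable_box.
apply/seteqP; split=> -[x y]; rewrite /region/=.
  by move=> /orP[/andP[h1 h2]|]; [left; rewrite /= !in_itv/= h1 h2|right].
by rewrite !in_itv/= andbT => -[[-> ->]//|->]; rewrite orbT.
Qed.

Variable nu : {sigma_finite_measure set R -> \bar R}.
Hypothesis nu_mu : is_mu 1 alpha nu.

Lemma mean_measure_box (a b u : R) : 0 <= a -> a <= b -> 0 < u ->
  mean_measure nu (`[a, b[%classic `*` `]u, +oo[%classic) =
  ((b - a) * u `^ (- alpha))%:E.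
Proof.
move=> a0 ab u0; rewrite /mean_measure product_measure1E//=.
rewrite nu_mu.2// mul1r EFinM; congr (_ * _)%E.
rewrite /mrestr setIidl; last first.
  by move=> x /=; rewrite !in_itv/= andbT => /andP[/(le_trans a0)].
rewrite lebesgue_measure_itv/= lte_fin EFinN.
have [|ba] := ltP a b; first by rewrite EFinB.
have -> : b = a by apply/eqP; rewrite eq_le ab ba.
by rewrite subrr.
Qed.

Lemma mean_measure_region x0 s : 0 <= x0 -> path later (0, x0) s ->
  all (fun q => 0 < q.1) s ->
  mean_measure nu (region x0 s) = (exponent x0 s)%:E.
Proof.
elim: s x0 => [|q s IH] x0 x00.
  move=> _ _; rewrite (_ : region _ _ = set0) ?/mean_measure ?measure0//.
  by apply/seteqP; split.
rewrite /= => /andP[xq qs] /andP[q0 s0].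
have q20 : 0 <= q.2 by exact: le_trans xq.
rewrite region_cons// /mean_measure measureU//.
- rewrite EFinD; congr (_ + _)%E.
    by apply: mean_measure_box => //; rewrite lowest_gt q0.
  by apply: IH => //; case: s qs {s0}.
- exact: measurable_box.
- exact: measurable_region.
- apply/seteqP; split => // -[x y] [[]]; rewrite /= !in_itv/= => /andP[_ xq2] _.
  by move=> /hasP[p _ /andP[/andP[]]]/=; rewrite leNgt xq2.
Qed.

End Staircases.

(** * The inverse extremal process *)

(** Gives bounds tending to 0 without inverting expR. *)
Lemma expRN_inv_le (R : realType) (e : R) : 0 < e -> expR (- e^-1) <= e.
Proof.
move=> e0; rewrite expRN -[leRHS]invrK lef_pV2 ?posrE ?expR_gt0 ?invr_gt0//.
by have := expR_ge1Dx e^-1; lra.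
Qed.

Section InverseExtremal.
Context (R : realType) d (Omega : measurableType d) (P : probability Omega R).
Variables (alpha : R) (nu : {sigma_finite_measure set R -> \bar R}).
Variables (t_ j_ : nat -> {RV P >-> R}).
Hypothesis alpha0 : 0 < alpha.
Hypothesis nu_mu : is_mu 1 alpha nu.
Hypothesis tj_poisson : poisson_atoms t_ j_ (mean_measure nu).

Local Notation Y := (first_exit j_ t_).

Lemma inverse_extremalE w u : inverse_extremal t_ j_ w u = Y w u.
Proof.
have [tj0 _ _ _] := tj_poisson.
apply: first_exit_unique => y; split=> [/ereal_infP H k uk|H].
  apply: H; exists (t_ k w) => //=; split; first by have [] := tj0 k w.
  apply: lt_le_trans (_ : ((j_ k w)%:E <= _)%E); first by rewrite lte_fin.
  by apply: ereal_sup_ubound; exists k => /=.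
apply/ereal_infP => _ [z [z0 uz] <-].
move/ereal_sup_gtP : uz => [_ [k /= tz <-]].
rewrite lte_fin => /H /le_trans; apply.
by rewrite lee_fin.
Qed.

Lemma count_atoms_eq0 (p : nat -> Omega -> R * R) (A : set (R * R)) w :
  count_atoms p A w = 0%:E <-> forall k, ~ A (p k w).
Proof.
split=> [H k Ak|H]; last first.
  by apply: eseries0 => k _ _; rewrite diracE memNset.
have : (1 <= count_atoms p A w)%E; last by rewrite H lee_fin ler10.
apply: (@le_trans _ _ (\sum_(0 <= i < k.+1) \d_(p i w) A)%E); last first.
  by apply: nneseries_lim_ge => i _ _.
rewrite big_nat_recr//= [X in (_ <= _ + X)%E]diracE mem_set//.
by rewrite leeDr// sume_ge0.
Qed.

(** A constraint (u, x) is violated precisely by an atom dated before x of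
    height above u. *)
Lemma above_regionP s w : above (Y w) s <->
  forall k, ~ region 0 s (t_ k w, j_ k w).
Proof.
have [tj0 _ _ _] := tj_poisson; split=> [/allP H k /hasP[q qs /=]|H].
  move=> /andP[/andP[_ h1] h2].
  have /first_exit_geP/(_ k h2) := H q qs.
  by rewrite lee_fin leNgt h1.
apply/allP => q qs; apply/first_exit_geP => k uk.
rewrite lee_fin leNgt; apply/negP => tq; apply: (H k); apply/hasP.
by exists q => //=; rewrite uk tq; have [-> _] := tj0 k w.
Qed.

Lemma probability_above s : path (@later R) (0, 0) s ->
  all (fun q => 0 < q.1) s ->
  P [set w | above (Y w) s] = (expR (- exponent alpha 0 s))%:E.
Proof.
move=> ps s0; have [_ Pn _ _] := tj_poisson.
have mr := mean_measure_region nu_mu (lexx 0) ps s0.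
have := Pn (region 0 s) (measurable_region 0 s).
rewrite mr ltry => /(_ isT 0%N).
rewrite /= expr0 fact0 divr1 mul1r => <-; congr (P _).
apply/seteqP; split=> w /=.
  by move=> /above_regionP H; apply/count_atoms_eq0.
by move=> /count_atoms_eq0 H; apply/above_regionP.
Qed.

Lemma probability_inverse_ge u x : 0 < u -> 0 <= x ->
  P [set w | (x%:E <= Y w u)%E] = (expR (- (x * u `^ (- alpha))))%:E.
Proof.
move=> u0 x0; have := @probability_above [:: (u, x)].
rewrite /= andbT/= /later/= x0 u0 subr0 addr0 => <- //; congr (P _).
by apply/seteqP; split=> w; rewrite /above/= andbT.
Qed.

Lemma inverse_exit_process : exit_process P j_ t_.
Proof.
have [tj0 _ _ _] := tj_poisson.
split=> [k|k|k w|u u0]; try exact: measurable_funP.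
  by have [] := tj0 k w.
apply/eqP; rewrite -measure_le0; apply/lee_addgt0Pr => e e0; rewrite add0e.
pose v := Num.max u 1; pose c := v `^ (- alpha).
have v0 : 0 < v by rewrite lt_max ltr01 orbT.
have c0 : 0 < c by exact: powR_gt0.
apply: (@le_trans _ _ (P [set w | ((e^-1 / c)%:E <= Y w v)%E])).
  apply: le_measure; rewrite ?inE.
  - rewrite first_exit_oo; last by move=> k w; have [] := tj0 k w.
    apply: bigcap_measurable => [|n _]; first by exists 0%N.
    by apply: measurable_first_exit => k; exact: measurable_funP.
  - by apply: measurable_first_exit => k; exact: measurable_funP.
  move=> w /= Yoo; have : (Y w u <= Y w v)%E.
    by apply: first_exit_nd; rewrite le_max lexx.
  by rewrite Yoo leye_eq => /eqP ->; rewrite leey.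
have ec0 : 0 <= e^-1 / c by rewrite divr_ge0 ?invr_ge0 ?(ltW e0) ?(ltW c0).
rewrite probability_inverse_ge// -/c divfK ?gt_eqF//.
by rewrite lee_fin expRN_inv_le.
Qed.

(** The event is the increasing union of the events x + 1 / (n + 1) <= Y w
    u. *)
Lemma probability_inverse_gt u x : 0 < u -> 0 < x ->
  P [set w | (x%:E < Y w u)%E] = (expR (- (u `^ (- alpha) * x)))%:E.
Proof.
move=> u0 x0; pose A (n : nat) := [set w | ((x + n.+1%:R^-1)%:E <= Y w u)%E].
have mY y : measurable [set w | (y%:E <= Y w u)%E].
  by apply: measurable_first_exit => k; exact: measurable_funP.
have AE : [set w | (x%:E < Y w u)%E] = \bigcup_n A n.
  apply/seteqP; split=> w /=; last first.
    move=> [n _]; apply: lt_le_trans.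
    by rewrite lte_fin ltrDl invr_gt0 ltr0n.
  case E : (Y w u) => [y| |]; last by rewrite ltNge leNye.
    rewrite lte_fin => xy; have yx : 0 < y - x by rewrite subr_gt0.
    exists (Num.truncn (y - x)^-1) => //; rewrite /A/= E lee_fin -lerBrDl.
    rewrite -[leRHS]invrK lef_pV2 ?posrE ?ltr0n ?invr_gt0//.
    exact/ltW/truncnS_gt.
  by move=> _; exists 0%N => //; rewrite /A/= E leey.
have ndA : nondecreasing_seq A.
  move=> m n mn; apply/subsetPset => w; apply: le_trans.
  by rewrite lee_fin lerD2l lef_pV2 ?posrE ?ltr0n// ler_nat.
have cA : P (A n) @[n --> \oo] --> P [set w | (x%:E < Y w u)%E].
  rewrite AE; apply: nondecreasing_cvg_mu => //; first by move=> n; exact: mY.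
  by apply: bigcup_measurable => n _; exact: mY.
have cE : P (A n) @[n --> \oo] --> (expR (- (u `^ (- alpha) * x)))%:E.
  have xn n : 0 <= x + n.+1%:R^-1 by rewrite addr_ge0 ?invr_ge0 ?(ltW x0).
  under eq_fun do rewrite probability_inverse_ge//.
  apply: cvg_EFin; first exact: nearW.
  apply: (@cvg_comp _ _ _ (fun n : nat => - ((x + n.+1%:R^-1) * u `^ (- alpha)))
    expR _ (nbhs (- (u `^ (- alpha) * x)))); last exact: continuous_expR.
  apply: cvgN; rewrite mulrC; apply: cvgM; last exact: cvg_cst.
  rewrite -[X in _ --> X]addr0; apply: cvgD; first exact: cvg_cst.
  exact: cvg_harmonic.
by rewrite -(cvg_lim _ cA)// -(cvg_lim _ cE).
Qed.

End InverseExtremal.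

(** * The rescaled first passage times *)

Section Walk.
Context (R : realType) d (Omega : measurableType d) (P : probability Omega R).
Variables (xi eta : {RV P >-> R}) (xi_ eta_ : nat -> {RV P >-> R}).
Hypothesis copies : independent_copies xi eta xi_ eta_.
Hypothesis xi_int : P.-integrable setT (EFin \o xi).
Variables (alpha : R) (l : R -> R).
Hypothesis alpha01 : 0 < alpha < 1.
Hypothesis l_sv : slowly_varying l.
Hypothesis eta_tail :
  tail P eta x / (x `^ (- alpha) * l x) @[x --> +oo] --> (1 : R).

Local Notation a := (tail P eta).

Lemma measurable_RV_gt (X : {RV P >-> R}) x : measurable [set w | x < X w].
Proof. by apply: measurable_gt_fun; exact: measurable_funP. Qed.

Lemma tail_ge0 t : 0 <= a t.
Proof. exact: fine_ge0. Qed.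

Lemma tail_ni s t : s <= t -> a t <= a s.
Proof.
move=> st; apply: fine_le; rewrite ?fin_num_measure//;
  try exact: measurable_RV_gt.
apply: le_measure; rewrite ?inE; try exact: measurable_RV_gt.
by move=> w /=; exact: le_lt_trans.
Qed.

Lemma tail_cvg0 : a t @[t --> +oo] --> (0 : R).
Proof.
have := cvg_ccdfy0 eta; move=> /fine_cvgP[_].
apply: cvg_trans; apply: near_eq_cvg; apply: nearW => t /=.
rewrite /tail /ccdf /distribution /pushforward; congr (fine (P _)).
by apply/seteqP; split=> w /=; rewrite in_itv/= andbT.
Qed.

Let a_gt0 : \forall t \near +oo, 0 < a t := regvar_gt0 tail_ge0 eta_tail.

Lemma probability_eta_le x : fine (P [set w | eta w <= x]) = 1 - a x.
Proof.
have -> : [set w | eta w <= x] = ~` [set w | x < eta w].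
  by apply/seteqP; split=> w /=; rewrite leNgt => /negP.
rewrite probability_setC; last exact: measurable_RV_gt.
by rewrite fineB ?fin_num_measure//; exact: measurable_RV_gt.
Qed.

(** Only the second coordinates of the pairs are constrained, so the
    dependence of xi and eta within a pair is harmless. *)
Lemma probability_eta_copies (B : nat -> set R) M :
  (forall k, measurable (B k)) ->
  fine (P [set w | forall k, (k < M)%N -> B k (eta_ k w)]) =
  \prod_(0 <= k < M) fine (P [set w | B k (eta w)]).
Proof.
move=> mB; pose A k : set (R * R) := setT `*` B k.
have mA k : measurable (A k) by apply: measurableX.
have mE (X : {RV P >-> R}) k : measurable [set w | B k (X w)].
  rewrite -[X in measurable X]setTI; exact: (measurable_funP X).
have := copies.1 (index_iota 0 M) A (iota_uniq _ _) mA.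
rewrite -bigcap_seq => E.
have -> : [set w | forall k, (k < M)%N -> B k (eta_ k w)] =
  \bigcap_(k in [set` index_iota 0 M])
    (fun w => (xi_ k w, eta_ k w)) @^-1` A k.
  apply/seteqP; split=> w H k /=; first by rewrite mem_index_iota => /H.
  by move=> kM; have := H k; rewrite /= mem_index_iota => /(_ kM)[].
rewrite E.
have -> : (\prod_(i <- index_iota 0 M)
    P ((fun w => (xi_ i w, eta_ i w)) @^-1` A i) =
    (\prod_(0 <= k < M) fine (P [set w | B k (eta w)]))%:E)%E.
  elim: (index_iota 0 M) => [|k s IH]; first by rewrite !big_nil.
  rewrite !big_cons EFinM -IH; congr (_ * _)%E.
  rewrite fineK ?fin_num_measure//.
  have := copies.2 k (A k) (mA k).
  rewrite (_ : [set w | A k (xi w, eta w)] = [set w | B k (eta w)]).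
    by move=> <-.
  by apply/seteqP; split=> w /=; [case|].
by [].
Qed.

(** Over that many terms the passage time, in units of 1 / P(eta > t), stays
    below x. *)
Definition steps (t x : R) : nat := nbelow (x / a t).

Definition step_bound (t : R) (s : seq (R * R)) (k : nat) : set R :=
  [set y | all (fun q => (k < steps t q.2)%N ==> (y <= q.1 * t)) s].

Definition eta_below (t : R) (s : seq (R * R)) : set Omega :=
  [set w | forall q k, q \in s -> (k < steps t q.2)%N -> eta_ k w <= q.1 * t].

(** The discrete analogue of expR (- exponent alpha x0 s). *)
Fixpoint stair_prob (t x0 : R) (s : seq (R * R)) : R :=
  if s is q :: s' then
    (1 - a (lowest q.1 s' * t)) ^+ (steps t q.2 - steps t x0) *
    stair_prob t q.2 s'
  else 1.

Lemma measurable_step_bound t s k : measurable (step_bound t s k).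
Proof.
elim: s => [|q s IH].
  by rewrite (_ : step_bound _ _ _ = setT)//; apply/seteqP; split.
rewrite (_ : step_bound _ _ _ =
  [set y | (k < steps t q.2)%N ==> (y <= q.1 * t)] `&` step_bound t s k).
  apply: measurableI => //.
  have -> : [set y | (k < steps t q.2)%N ==> (y <= q.1 * t)] =
      if (k < steps t q.2)%N then `]-oo, q.1 * t]%classic else setT.
    by apply/seteqP; split=> y /=; case: ifP => //=; rewrite in_itv.
  by case: ifP => _; [exact: measurable_itv|exact: measurableT].
by apply/seteqP; split=> y /= /andP.
Qed.

Lemma steps_le t x y : 0 < a t -> 0 <= x -> x <= y ->
  (steps t x <= steps t y)%N.
Proof.
move=> at0 x0 xy; apply: nbelow_le; first by rewrite divr_ge0// ltW.
by rewrite ler_pM2r ?invr_gt0.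
Qed.

Lemma eta_belowE t s xm : 0 < a t -> all (fun q => 0 <= q.2 <= xm) s ->
  eta_below t s =
  [set w | forall k, (k < steps t xm)%N -> step_bound t s k (eta_ k w)].
Proof.
move=> at0 /allP sx; apply/seteqP; split=> w H.
  move=> k kM; apply/allP => q qs; apply/implyP => kq; exact: H.
move=> q k qs kq; have /andP[q0 qx] := sx q qs.
have /H/allP/(_ q qs)/implyP : (k < steps t xm)%N.
  by rewrite (leq_trans kq)// steps_le.
exact.
Qed.

(** The same decomposition as in region_cons: up to step steps t q.2 all
    constraints are active, afterwards q has expired. *)
Lemma prod_step_bound t x0 s xm : 0 < t -> 0 < a t -> 0 <= x0 <= xm ->
  path (@later R) (0, x0) s -> all (fun q => q.2 <= xm) s ->
  \prod_(steps t x0 <= k < steps t xm)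
    fine (P [set w | step_bound t s k (eta w)]) = stair_prob t x0 s.
Proof.
move=> t0 at0; elim: s x0 => [|q s IH] x0 /andP[x00 x0m].
  move=> _ _; apply: big1 => k _.
  rewrite (_ : [set w | step_bound t [::] k (eta w)] = setT).
    by rewrite (_ : P setT = 1%E)//; exact: probability_setT.
  by apply/seteqP; split.
move=> /= /andP[x0q qs] /andP[qm sm].
have q0 : 0 <= q.2 := le_trans x00 x0q.
have qs' : path (@later R) (0, q.2) s by case: s qs {IH sm}.
rewrite (big_cat_nat (n := steps t q.2))/=; try exact: steps_le.
congr (_ * _).
  rewrite -prodr_const_nat; apply: eq_big_nat => k /andP[_ kq].
  rewrite -probability_eta_le; congr (fine (P _)).
  rewrite (_ : [set w | eta w <= _] =
    [set w | (eta w <= q.1 * t) && all (fun p => eta w <= p.1 * t) s]).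
    apply/seteqP; split=> w; rewrite /step_bound/= kq/=;
    move=> /andP[-> /allP H]; apply/allP => p ps; have := H p ps.
      move=> /implyP; apply; rewrite (leq_trans kq)//.
      by apply: steps_le => //; exact: (allP (path_later qs)).
    by move=> ->; rewrite implybT.
  have E y : (y <= lowest q.1 s * t) =
      (y <= q.1 * t) && all (fun p => y <= p.1 * t) s.
    rewrite -ler_pdivrMr// lowest_ge ler_pdivrMr//; congr (_ && _).
    by apply: eq_all => p; rewrite ler_pdivrMr.
  by apply/seteqP; split=> w /=; rewrite E.
rewrite -(IH _ _ qs')//; last by rewrite q0.
apply: eq_big_nat => k /andP[kq _]; congr (fine (P _)).
apply/seteqP; split=> w; rewrite /step_bound/=; first by move=> /andP[].
by move=> ->; rewrite ltnNge kq.
Qed.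

Lemma probability_eta_below t s xm : 0 < t -> 0 < a t -> 0 <= xm ->
  path (@later R) (0, 0) s -> all (fun q => q.2 <= xm) s ->
  measurable (eta_below t s) /\
  fine (P (eta_below t s)) = stair_prob t 0 s.
Proof.
move=> t0 at0 xm0 ps sm.
have sx : all (fun q => 0 <= q.2 <= xm) s.
  apply/allP => q qs; rewrite (allP sm)// andbT.
  exact: (allP (path_later ps)).
have st0 : steps t 0 = 0%N.
  by rewrite /steps mul0r /nbelow ceil0.
rewrite (eta_belowE at0 sx); split.
  rewrite (_ : [set _ | _] = \bigcap_(k in [set k | (k < steps t xm)%N])
    (eta_ k @^-1` step_bound t s k)).
    apply: bigcap_measurableType => k _.
    rewrite -[X in measurable X]setTI.
    exact: (measurable_funP (eta_ k) _ _ (measurable_step_bound _ _ _)).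
  by apply/seteqP; split=> w H k /H.
rewrite probability_eta_copies; last by move=> k; exact: measurable_step_bound.
by rewrite -(@prod_step_bound t 0 s xm)// ?lexx// st0.
Qed.

Lemma tail_scale_cvg0 u : 0 < u -> a (u * t) @[t --> +oo] --> (0 : R).
Proof.
move=> u0; apply: cvg_comp tail_cvg0.
by apply: gt0_cvgMry => //; exact: cvg_id.
Qed.

Lemma steps_cvg x : 0 <= x -> (steps t x)%:R * a t @[t --> +oo] --> x.
Proof. by move=> x0; apply: nbelow_cvg => //; exact: tail_cvg0. Qed.

Lemma stair_prob_cvg x0 s : 0 <= x0 -> path (@later R) (0, x0) s ->
  all (fun q => 0 < q.1) s ->
  stair_prob t x0 s @[t --> +oo] --> expR (- exponent alpha x0 s).
Proof.
elim: s x0 => [|q s IH] x0 x00 /=.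
  by move=> _ _; rewrite oppr0 expR0; exact: cvg_cst.
move=> /andP[x0q qs] /andP[q0 s0].
have qs' : path (@later R) (0, q.2) s by case: s qs {IH s0}.
have q20 : 0 <= q.2 := le_trans x00 x0q.
have l0 : 0 < lowest q.1 s by rewrite lowest_gt q0.
rewrite opprD expRD; apply: cvgM; last exact: IH.
apply: compound_cvg.
- by apply: nearW => t; exact: tail_ge0.
- exact: tail_scale_cvg0.
have H : ((steps t q.2)%:R * a t - (steps t x0)%:R * a t) *
    (a (lowest q.1 s * t) / a t) @[t --> +oo] -->
    (q.2 - x0) * lowest q.1 s `^ (- alpha).
  apply: cvgM; first by apply: cvgB; exact: steps_cvg.
  exact: (regvar_ratio tail_ge0 l_sv eta_tail l0).
apply: cvg_trans H; apply: near_eq_cvg; apply: filterS a_gt0 => t at0 /=.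
rewrite natrB; last exact: steps_le.
by field; rewrite gt_eqF.
Qed.

Lemma horizon (s : seq (R * R)) :
  exists xm, 0 <= xm /\ all (fun q => q.2 <= xm) s.
Proof.
elim: s => [|q s [xm [xm0 /allP sm]]]; first by exists 0.
exists (Num.max q.2 xm); rewrite le_max xm0 orbT; split => //=.
rewrite le_max lexx/=; apply/allP => p /sm pm.
by rewrite le_max pm orbT.
Qed.

Lemma eta_below_cvg s : path (@later R) (0, 0) s -> all (fun q => 0 < q.1) s ->
  fine (P (eta_below t s)) @[t --> +oo] --> expR (- exponent alpha 0 s).
Proof.
move=> ps s0; apply: cvg_trans (stair_prob_cvg (lexx 0) ps s0).
apply: near_eq_cvg.
have t0 : \forall t \near +oo, (0 : R) < t by exists 0; split.
have [xm [xm0 sm]] := horizon s.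
apply: filterS2 t0 a_gt0 => t t0 at0.
by rewrite (probability_eta_below t0 at0 xm0 ps sm).2.
Qed.

Definition absum (n : nat) (w : Omega) : R := \sum_(k < n) `|xi_ k w|.

Lemma walk_le_absum m n w : (m <= n)%N -> `|walk xi_ m w| <= absum n w.
Proof.
move=> mn; apply: le_trans (ler_norm_sum _ _ _) _.
rewrite /absum -!(big_mkord xpredT (fun k => `|xi_ k w|)).
by rewrite (big_cat_nat (n := m) (p := n))//= lerDl sumr_ge0.
Qed.

(** Equidistributed pairs have equidistributed first coordinates. *)
Lemma integral_abs_copies k :
  (\int[P]_w `|xi_ k w|%:E = \int[P]_w `|xi w|%:E)%E.
Proof.
have mabs : measurable_fun [set: R] (fun y : R => `|y|%:E).
  by apply/measurable_EFinP; exact: normr_measurable.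
have abs0 (y : R) : (0 <= `|y|%:E)%E by rewrite lee_fin.
rewrite -(ge0_integral_distribution (xi_ k) mabs abs0).
rewrite -(ge0_integral_distribution xi mabs abs0).
apply: eq_measure_integral => A mA _; rewrite /distribution /pushforward.
have mAT : measurable (A `*` [set: R]) by exact: measurableX.
have := copies.2 k _ mAT; congr (_ = _); congr (P _).
  by apply/seteqP; split=> w //= [].
by apply/seteqP; split=> w //= [].
Qed.

Lemma integrable_abs_copies k :
  P.-integrable setT (EFin \o (fun w => `|xi_ k w|)).
Proof.
apply/integrableP; split.
  by apply/measurable_EFinP; apply: measurableT_comp.
have /integrableP[_] := xi_int; apply: le_lt_trans.
under eq_integral do rewrite /= normr_id.
by rewrite integral_abs_copies.
Qed.

Lemma Rintegral_absum n : P.-integrable setT (EFin \o absum n) /\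
  (\int[P]_w absum n w)%R = n%:R * (\int[P]_w `|xi w|)%R.
Proof.
elim: n => [|n [IHi IH]].
  have E : absum 0 = fun=> 0 by apply/funext => w; rewrite /absum big_ord0.
  rewrite E mul0r probability_Rintegral_cst; split => //.
  by apply: (@bounded_integrable _ _ _ _ _ `|0|) => [|w];
    [exact: measurable_cst|exact: lexx].
have E : absum n.+1 = fun w => absum n w + `|xi_ n w|.
  by apply/funext => w; rewrite /absum big_ord_recr.
have ik := integrable_abs_copies n; rewrite E; split.
  rewrite (_ : _ \o _ =
    ((EFin \o absum n) \+ (EFin \o (fun w => `|xi_ n w|%R)))%E).
    exact: integrableD.
  by apply/funext => w.
rewrite RintegralD// IH -natr1 mulrDl mul1r; congr (_ + fine _).
exact: integral_abs_copies.
Qed.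

Lemma measurable_absum n : measurable_fun setT (absum n).
Proof.
by apply: measurable_sum => k; apply: measurableT_comp.
Qed.

Lemma absum_markov n c : 0 < c ->
  c * fine (P [set w | c < absum n w]) <= n%:R * (\int[P]_w `|xi w|)%R.
Proof.
move=> c0; have [ia <-] := Rintegral_absum n.
have := measurable_gt_fun c (measurable_absum n); set A := [set w | _] => mA.
have -> : fine (P A) =
    (\int[P]_w (\1_A w))%R.
  by rewrite /Rintegral integral_indic// setIT.
have i1 : P.-integrable setT (EFin \o \1_A).
  apply: (@bounded_integrable _ _ _ _ _ 1) => // w.
  by rewrite indicE; case: (_ \in _); rewrite ?normr1 ?normr0.
rewrite -RintegralZl//; apply: le_Rintegral => //.
  rewrite (_ : _ \o _ = (fun w => c%:E * (EFin \o \1_A) w)%E).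
    exact: integrableZl.
  by apply/funext => w.
move=> w _; rewrite indicE; have [|_] := boolP (w \in _).
  by rewrite inE /A/= mulr1 => /ltW.
by rewrite mulr0 sumr_ge0.
Qed.

(** By the Markov inequality the probability is at most a constant times 1 /
    (t a(t)). Here alpha < 1 enters. *)
Lemma absum_negligible xm e : 0 <= xm -> 0 < e ->
  fine (P [set w | e * t < absum (steps t xm) w]) @[t --> +oo] --> (0 : R).
Proof.
move=> xm0 e0; apply/cvgrPdist_le => /= del del0.
have t0 : \forall t \near +oo, (0 : R) < t by exists 0; split.
set E := (\int[P]_w `|xi w|)%R.
have E0 : 0 <= E by apply: Rintegral_ge0.
have /cvgryPge/(_ (xm * E / (e * del))) :=
  regvar_mul_pinfty alpha01 tail_ge0 tail_ni l_sv eta_tail.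
apply: filterS3 t0 a_gt0 => t t0 at0 h.
rewrite sub0r normrN ger0_norm ?fine_ge0//.
have et : 0 < e * t by exact: mulr_gt0.
have ed : 0 < e * del by exact: mulr_gt0.
have := absum_markov (steps t xm) et; rewrite -/E; set p := fine _ => hp.
have /nbelow_bounds/andP[_ hs] : 0 <= xm / a t by rewrite divr_ge0// ltW.
rewrite -/(steps t xm) in hs.
have {hs} hs : (steps t xm)%:R * E <= xm / a t * E by rewrite ler_wpM2r.
have {}hp : p <= xm / a t * E / (e * t).
  by rewrite ler_pdivlMr// mulrC (le_trans hp).
apply: le_trans hp _; rewrite ler_pdivrMr// mulrAC ler_pdivrMr//.
by move: h; rewrite ler_pdivrMr//; lra.
Qed.

Definition scaled_walk (t : R) (k : nat) (w : Omega) : R :=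
  pert_walk xi_ eta_ k.+1 w / t.

Definition scaled_time (t : R) (k : nat) (w : Omega) : R := a t * k.+1%:R.

Local Notation X t := (first_exit (scaled_walk t) (scaled_time t)).

Lemma measurable_scaled_walk t k : measurable_fun setT (scaled_walk t k).
Proof.
apply: measurable_funM => //; apply: measurable_funD.
  by apply: measurable_sum => i; exact: measurable_funP.
exact: measurable_funP.
Qed.

(** T_0 is left out by the condition 1 <= n in first_passage, whence the
    index shift between n and k + 1. *)
Lemma scaled_first_passageE t u w : 0 < t -> 0 < a t ->
  ((a t)%:E * first_passage xi_ eta_ (u * t) w)%E = X t w u.
Proof.
move=> t0 at0; apply: first_exit_unique => y.
rewrite -lee_pdivrMl//; split=> [/ereal_infP H k|H].
  rewrite /scaled_walk ltr_pdivlMr// => uk.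
  rewrite /scaled_time EFinM -lee_pdivrMl//; apply: H.
  by exists k.+1.
apply/ereal_infP => _ [[|k]/= [//_ uk] <-].
rewrite lee_pdivrMl// -EFinM; apply: H.
by rewrite /scaled_walk ltr_pdivlMr.
Qed.

(** The points with scaled date below q.2 are those with fewer than steps t
    q.2 predecessors, and none of them may exceed the level. *)
Lemma above_walkP t s w : 0 < t -> 0 < a t -> all (fun q => 0 <= q.2) s ->
  above (X t w) s <-> forall q k, q \in s -> (k < steps t q.2)%N ->
    walk xi_ k w + eta_ k w <= q.1 * t.
Proof.
move=> t0 at0 /allP s0; split=> [/allP H q k qs|H].
  rewrite /steps nbelowP ?divr_ge0 ?s0// ?tail_ge0//.
  rewrite ltr_pdivlMr// mulrC => kq; rewrite leNgt; apply/negP => h.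
  have /first_exit_geP/(_ k) := H q qs.
  rewrite /scaled_walk ltr_pdivlMr// => /(_ h).
  by rewrite lee_fin leNgt /scaled_time kq.
apply/allP => q qs; apply/first_exit_geP => k.
rewrite /scaled_walk ltr_pdivlMr// lee_fin => h.
rewrite leNgt; apply/negP => kq.
have := H q k qs; rewrite /steps nbelowP ?divr_ge0 ?s0// ?tail_ge0//.
rewrite ltr_pdivlMr// mulrC => /(_ kq).
by rewrite leNgt => /negP; apply.
Qed.

Lemma fine_probability_cover (A B C : set Omega) :
  measurable A -> measurable B -> measurable C -> A `<=` B `|` C ->
  fine (P A) <= fine (P B) + fine (P C).
Proof.
move=> mA mB mC ABC; rewrite -fineD ?fin_num_measure//.
apply: fine_le; rewrite ?fin_numD ?fin_num_measure//.
apply: le_trans (_ : (P (B `|` C) <= _)%E).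
  by apply: le_measure; rewrite ?inE//; exact: measurableU.
by apply: measureU2.
Qed.

Lemma path_shift (e : R) (q q' : R * R) (s : seq (R * R)) : q.2 = q'.2 ->
  path (@later R) q (shift_levels e s) = path (@later R) q' s.
Proof.
elim: s q q' => [//|r s IH] q q' qq' /=.
by rewrite (IH (r.1 + e, r.2) r)// /later/= qq'.
Qed.

(** As long as the walk stays within e t over the relevant steps, replacing
    T_n by eta_n amounts to moving the levels by at most e, in either
    direction. *)
Lemma above_cvg s : path (@later R) (0, 0) s -> all (fun q => 0 < q.1) s ->
  fine (P [set w | above (X t w) s]) @[t --> +oo] -->
  expR (- exponent alpha 0 s).
Proof.
move=> ps s0; apply/cvgrPdist_le => /= del del0.
have del3 : 0 < del / 3 by lra.
have ge : expR (- exponent alpha 0 (shift_levels e s)) @[e --> (0 : R)] -->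
    expR (- exponent alpha 0 s).
  apply: (@cvg_comp _ _ _ (fun e => - exponent alpha 0 (shift_levels e s))
    expR _ (nbhs (- exponent alpha 0 s))); last exact: continuous_expR.
  by apply: cvgN; exact: exponent_shift_cvg.
have pos : \forall e \near (0 : R), all (fun q => 0 < q.1) (shift_levels e s).
  elim: s s0 {ps ge} => [_|q s IH /= /andP[q0 /IH {}IH]].
    by exists 1 => //=.
  have q1 : \forall e \near (0 : R), 0 < q.1 + e.
    by exists q.1 => //= e /=; rewrite ltr_norml; lra.
  by apply: filterS2 q1 IH => e -> ->.
have [r /= r0 hr] : \forall e \near (0 : R),
    `|expR (- exponent alpha 0 s) -
      expR (- exponent alpha 0 (shift_levels e s))| <= del / 3 /\
    all (fun q => 0 < q.1) (shift_levels e s).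
  by apply: filterI pos; move/cvgrPdist_le : ge; apply.
(* half the radius, so that both e and - e lie in the neighbourhood *)
pose e := r / 2; have e0 : 0 < e by rewrite /e; lra.
have [gp pp] := hr e ltac:(rewrite /= /e ltr_norml; lra).
have [gm pm] := hr (- e) ltac:(rewrite /= /e ltr_norml; lra).
have [xm [xm0 sm]] := horizon s.
have sms c : all (fun q => q.2 <= xm) (shift_levels c s).
  by rewrite all_map; exact: sm.
have pss c : path (@later R) (0, 0) (shift_levels c s).
  by rewrite (@path_shift _ _ (0, 0)).
have s02 : all (fun q : R * R => 0 <= q.2) s := path_later ps.
have /cvgrPdist_le/(_ _ del3) Cp := eta_below_cvg (pss e) pp.
have /cvgrPdist_le/(_ _ del3) Cm := eta_below_cvg (pss (- e)) pm.
have /cvgrPdist_le/(_ _ del3) CH := absum_negligible xm0 e0.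
near=> t.
have t0 : 0 < t by near: t; exists 0; split.
have at0 : 0 < a t by near: t.
have cp : `|expR (- exponent alpha 0 (shift_levels e s)) -
    fine (P (eta_below t (shift_levels e s)))| <= del / 3 by near: t; exact: Cp.
have cm : `|expR (- exponent alpha 0 (shift_levels (- e) s)) -
    fine (P (eta_below t (shift_levels (- e) s)))| <= del / 3.
  by near: t; exact: Cm.
have : `|0 - fine (P [set w | e * t < absum (steps t xm) w])| <= del / 3.
  by near: t; exact: CH.
set H := [set w | e * t < absum (steps t xm) w] => cH.
have mH : measurable H by apply: measurable_gt_fun; exact: measurable_absum.
have [mp _] := probability_eta_below t0 at0 xm0 (pss e) (sms e).
have [mm _] := probability_eta_below t0 at0 xm0 (pss (- e)) (sms (- e)).
have mE : measurable [set w | above (X t w) s].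
  apply: measurable_above => k; first exact: measurable_scaled_walk.
  exact: measurable_cst.
have small w q k : ~ H w -> q \in s -> (k < steps t q.2)%N ->
    - (e * t) <= walk xi_ k w <= e * t.
  move=> /negP; rewrite -leNgt => Hw qs kq; rewrite -ler_norml.
  apply: le_trans Hw; apply: walk_le_absum.
  apply: ltnW; rewrite (leq_trans kq)// steps_le//.
    exact: (allP s02).
  exact: (allP sm).
have : fine (P [set w | above (X t w) s]) <=
    fine (P (eta_below t (shift_levels e s))) + fine (P H).
  apply: fine_probability_cover => // w /(above_walkP _ t0 at0 s02) Ew.
  have [Hw|Hw] := pselect (H w); [by right|left].
  move=> _ k /mapP[q qs ->] /= kq; have := Ew q k qs kq.
  by have := small w q k Hw qs kq; lra.
have : fine (P (eta_below t (shift_levels (- e) s))) <=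
    fine (P [set w | above (X t w) s]) + fine (P H).
  apply: fine_probability_cover => // w Ww.
  have [Hw|Hw] := pselect (H w); [by right|left].
  apply/(above_walkP _ t0 at0 s02) => q k qs kq.
  have := Ww (q.1 - e, q.2) k; rewrite /= => /(_ _ kq) h.
  have {}h : eta_ k w <= (q.1 - e) * t by apply: h; apply/mapP; exists q.
  by have := small w q k Hw qs kq; lra.
have hH : 0 <= fine (P H) by exact: fine_ge0.
move: gp gm cp cm cH; rewrite !ler_norml.
by move=> /andP[? ?] /andP[? ?] /andP[? ?] /andP[? ?] /andP[? ?]; lra.
Unshelve. all: by end_near. Qed.

Lemma probability_passage_ge_cvg u x : 0 < u -> 0 <= x ->
  fine (P [set w | (x%:E <= X t w u)%E]) @[t --> +oo] -->
  expR (- (x * u `^ (- alpha))).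
Proof.
move=> u0 x0; have := @above_cvg [:: (u, x)].
rewrite /= /later/= x0 u0 subr0 addr0 => /(_ isT isT).
have E t : [set w | above (X t w) [:: (u, x)]] = [set w | (x%:E <= X t w u)%E].
  by apply/seteqP; split=> w; rewrite /above/= andbT.
by under eq_fun do rewrite E.
Qed.

(** If u t is never exceeded, then neither is any larger t'; the probability
    of this is at most that of a passage time over t' of at least x / a(t'),
    which is close to exp(- x) for large t', and x is arbitrary. *)
Lemma passage_exit_process :
  \forall t \near +oo, exit_process P (scaled_walk t) (scaled_time t).
Proof.
have tpos : \forall t \near +oo, (0 : R) < t by exists 0; split.
have mX t u x : measurable [set w | (x%:E <= X t w u)%E].
  apply: measurable_first_exit => k; first exact: measurable_scaled_walk.
  exact: measurable_cst.
apply: filterS2 (tpos) a_gt0 => t t0 at0.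
have c0 k w : 0 <= scaled_time t k w by rewrite /scaled_time mulr_ge0// ltW.
split=> // [k|k|u u0]; first exact: measurable_scaled_walk.
  exact: measurable_cst.
apply/eqP; rewrite -measure_le0; apply/lee_addgt0Pr => e e0; rewrite add0e.
have e2 : 0 < e / 2 by lra.
have ei : 0 <= (e / 2)^-1 by rewrite invr_ge0 ltW.
have /cvgrPdist_le/(_ _ e2) := probability_passage_ge_cvg ltr01 ei.
rewrite powR1 mulr1 => lim.
have big : \forall t' \near +oo, u * t <= t'.
  by exists (u * t); split => [|t' /ltW//]; exact: num_real.
have [t' [ht' [ut t'0]]] := filter_ex (filterI lim (filterI big tpos)).
have mN : measurable [set w | X t w u = +oo%E].
  rewrite first_exit_oo//.
  apply: bigcap_measurable => [|n _]; first by exists 0%N.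
  exact: mX.
have le : (P [set w | X t w u = +oo%E] <=
    P [set w | ((e / 2)^-1%:E <= X t' w 1)%E])%E.
  apply: le_measure; [by rewrite inE|by rewrite inE; exact: mX|].
  move=> w /= Xoo; apply/first_exit_geP => k.
  rewrite /scaled_walk ltr_pdivlMr// mul1r => t'T.
  have /first_exit_geP/(_ k) : (+oo <= X t w u)%E by rewrite Xoo.
  rewrite /scaled_walk ltr_pdivlMr// => /(_ (le_lt_trans ut t'T)).
  by rewrite leye_eq.
have m1 := mX t' 1 (e / 2)^-1.
apply: le_trans le _; rewrite -[leLHS]fineK ?fin_num_measure//.
rewrite lee_fin; have := expRN_inv_le e2.
by move: ht'; rewrite ler_norml; lra.
Qed.

End Walk.

(** * Reduction of finite-dimensional events to staircases *)

Section Reduction.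
Variable R : realType.

Lemma above_filter (Z : R -> \bar R) (s : seq (R * R)) :
  (forall u, (0 <= Z u)%E) -> above Z s = above Z [seq q <- s | 0 < q.2].
Proof.
move=> Z0; elim: s => [//|q s IH] /=; case: ltP => q0 /=; first by rewrite IH.
by rewrite IH (le_trans _ (Z0 _))// lee_fin.
Qed.

Lemma above_sort (Z : R -> \bar R) (s : seq (R * R)) :
  above Z s = above Z (sort (@later R) s).
Proof. by apply/esym/perm_all; rewrite perm_sort. Qed.

Lemma sort_path_later (s : seq (R * R)) : all (fun q => 0 < q.2) s ->
  path (@later R) (0, 0) (sort (@later R) s).
Proof.
move=> s0; rewrite path_min_sorted.
  by apply: sort_sorted => p q; exact: le_total.
rewrite all_sort; apply/allP => q qs; apply/ltW; exact: (allP s0).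
Qed.

(** Settles the coordinate u = 0, where both processes are below every
    positive x with high probability: by monotonicity a low positive level
    will do. *)
Lemma low_level (alpha x del : R) : 0 < alpha -> 0 < x -> 0 < del ->
  exists2 u : R, 0 < u & expR (- (x * u `^ (- alpha))) <= del.
Proof.
move=> a0 x0 d0; have dx : 0 < del^-1 / x by rewrite divr_gt0 ?invr_gt0.
exists ((del^-1 / x) `^ (- alpha^-1)); first exact: powR_gt0.
rewrite -powRrM mulrNN mulVf ?gt_eqF// powRr1 ?(ltW dx)//.
by rewrite mulrC divfK ?gt_eqF// expRN_inv_le.
Qed.

End Reduction.

Theorem theorem2p10 (R : realType)
    (d : measure_display) (Omega : measurableType d) (P : probability Omega R)
    (xi eta : {RV P >-> R}) (xi_ eta_ : nat -> {RV P >-> R})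
    (copies : independent_copies xi eta xi_ eta_)
    (mu : R) (xi_int : P.-integrable setT (EFin \o xi))
    (xi_mean : ('E_P[xi])%E = mu%:E)
    (alpha : R) (alpha01 : 0 < alpha < 1)
    (l : R -> R) (l_sv : slowly_varying l)
    (eta_tail : tail P eta x / (x `^ (- alpha) * l x) @[x --> +oo] --> (1 : R))
    (d' : measure_display) (Omega' : measurableType d')
    (P' : probability Omega' R)
    (nu : {sigma_finite_measure set R -> \bar R}) (nu_mu : is_mu 1 alpha nu)
    (t_ j_ : nat -> {RV P' >-> R})
    (tj_poisson : poisson_atoms t_ j_ (mean_measure nu)) :
  cvg_law_M1 P P'
    (fun t w u => ((tail P eta t)%:E * first_passage xi_ eta_ (u * t) w)%E)
    (inverse_extremal t_ j_) /\
  forall x u : R, 0 < x -> 0 < u ->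
    P' [set w | (x%:E < inverse_extremal t_ j_ w u)%E] =
    (expR (- (u `^ (- alpha) * x)))%:E.
Proof.
have YE : inverse_extremal t_ j_ = first_exit j_ t_.
  apply/funext => w; apply/funext => u.
  exact: inverse_extremalE tj_poisson _ _.
split; last first.
  move=> x u x0 u0; rewrite YE.
  exact: (probability_inverse_gt nu_mu tj_poisson u0 x0).
rewrite YE.
have /andP[alpha0 _] := alpha01.
have Xproc := passage_exit_process copies xi_int alpha01 l_sv eta_tail.
have Yproc := inverse_exit_process nu_mu tj_poisson.
have tpos : \forall t \near +oo, (0 : R) < t by exists 0; split.
have apos := regvar_gt0 (tail_ge0 eta) eta_tail.
set X := fun t => first_exit (scaled_walk xi_ eta_ t) (scaled_time eta t).
suff : cvg_law_M1 P P' X (first_exit j_ t_).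
  move=> [rX rY cXY]; have XE : \forall t \near +oo,
      (fun w u =>
        ((tail P eta t)%:E * first_passage xi_ eta_ (u * t) w)%E) = X t.
    apply: filterS2 tpos apos => t t0 at0; apply/funext => w; apply/funext => u.
    exact: scaled_first_passageE.
  split=> // [|f cf bf]; first by apply: filterS2 rX XE => t + ->.
  apply: cvg_trans (cXY f cf bf); apply: near_eq_cvg.
  apply: filterS XE => t Et; congr (expectation P _); apply/funext => w.
  by have /= -> := congr1 (fun Z => Z w) Et.
apply: fdd_cvg_law_M1 => // s s0.
have Xge0 : \forall t \near +oo, forall w u, (0 <= X t w u)%E.
  by apply: filterS Xproc => t ht w u; exact: first_exit_ge0 ht _ _.
have Yge0 w u : (0 <= first_exit j_ t_ w u)%E.
  exact: first_exit_ge0 Yproc _ _.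
pose s1 := [seq q <- s | 0 < q.2].
have s12 : all (fun q => 0 < q.2) s1 by exact: filter_all.
have s10 : all (fun q => 0 <= q.1) s1.
  by rewrite all_filter; apply: sub_all s0 => q q0; apply/implyP.
have -> : [set w | above (first_exit j_ t_ w) s] =
    [set w | above (first_exit j_ t_ w) s1].
  by apply/seteqP; split=> w /=; rewrite [above _ s](above_filter _ (Yge0 w)).
apply: (@cvg_trans _ (fine (P [set w | above (X t w) s1]) @[t --> +oo])).
  apply: near_eq_cvg; apply: filterS Xge0 => t X0; congr (fine (P _)).
  by apply/seteqP; split=> w /=; rewrite [above _ s](above_filter _ (X0 w)).
(* a constraint at level 0 makes both probabilities small *)
have [/hasP[q qs /eqP q10]|/hasPn n0] := boolP (has (fun q => q.1 == 0) s1).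
  have q20 := allP s12 _ qs.
  have mY z : measurable [set w | above (first_exit j_ t_ w) z].
    by apply: measurable_above => k; exact: measurable_funP.
  have mY1 v x : measurable [set w | (x%:E <= first_exit j_ t_ w v)%E].
    by apply: measurable_first_exit => k; exact: measurable_funP.
  have -> : fine (P' [set w | above (first_exit j_ t_ w) s1]) = 0.
    apply/eqP; rewrite eq_le fine_ge0// andbT.
    apply/ler_addgt0Pr => e e0; rewrite add0r.
    have [u u0 ue] := low_level alpha0 q20 e0.
    apply: le_trans ue; rewrite -lee_fin fineK ?fin_num_measure//.
    rewrite -(probability_inverse_ge nu_mu tj_poisson u0 (ltW q20)).
    apply: le_measure; rewrite ?inE// => w /allP/(_ q qs)/le_trans; apply.
    by apply: first_exit_nd; rewrite q10 ltW.
  apply/cvgrPdist_le => /= e e0; have e2 : 0 < e / 2 by lra.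
  have [u u0 ue] := low_level alpha0 q20 e2.
  have /cvgrPdist_le/(_ _ e2) := probability_passage_ge_cvg copies xi_int
    alpha01 l_sv eta_tail u0 (ltW q20).
  apply: filterS2 Xproc => t [mh mc _ _]; rewrite -/(X t).
  set A := [set w | (_ <= X t w u)%E] => hA.
  have AB : fine (P [set w | above (X t w) s1]) <= fine (P A).
    apply: fine_le; rewrite ?fin_num_measure//.
    - exact: measurable_above.
    - exact: measurable_first_exit.
    apply: le_measure; rewrite ?inE//.
    - exact: measurable_above.
    - exact: measurable_first_exit.
    move=> w /allP/(_ q qs)/le_trans; apply.
    by apply: first_exit_nd; rewrite q10 ltW.
  rewrite sub0r normrN ger0_norm ?fine_ge0//.
  by move: hA; rewrite ler_norml; lra.
have s1pos : all (fun q => 0 < q.1) s1.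
  by apply/allP => q qs; rewrite lt_def n0// (allP s10).
have ps := sort_path_later s12.
have sp : all (fun q => 0 < q.1) (sort (@later R) s1) by rewrite all_sort.
have E T (Z : T -> R -> \bar R) : [set w | above (Z w) s1] =
    [set w | above (Z w) (sort (@later R) s1)].
  by apply/seteqP; split=> w /=; rewrite -above_sort.
rewrite E (probability_above nu_mu tj_poisson ps sp).
under eq_fun do rewrite E.
exact: (above_cvg copies xi_int alpha01 l_sv eta_tail ps sp).
Qed.
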